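(* Let $H$ be a collection of probability measures on a measurable space $\mathcal{X}$, and let $Q$ be a probability measure on $\mathcal{X}$ with generalized Lebesgue decomposition $Q=Q_a+Q_s$ with respect to $H$. Let $\alpha\in[0,1]$ and $h<1$, let $U_{\alpha,h}$ be the capped power utility, and let $\varepsilon^{(\alpha,h)}\in\mathcal{E}(H)$ be a valid e-value taking values in $[0,1/\alpha]$. If $\alpha=0$ and $0<h<1$, assume additionally that $$\mathrm{E}^{Q_a}\left[\left(\varepsilon^{(\alpha,h)}\right)^h\right]<\infty.$$ Then the following statements are equivalent: 1. $\varepsilon^{(\alpha,h)}$ is $U_{\alpha,h}$-optimal; 2. for every valid e-value $\varepsilon\in\mathcal{E}(H)$ taking values in $[0,1/\alpha]$, $\left(\varepsilon^{(\alpha,h)}\right)^{h-1}\left(\varepsilon-\varepsilon^{(\alpha,h)}\right)$ is $Q_a$-integrable and $$\mathrm{E}^{Q_a}\left[\left(\varepsilon^{(\alpha,h)}\right)^{h-1}\left(\varepsilon-\varepsilon^{(\alpha,h)}\right)\right]\le 0;$$ 3. there exist $\lambda^*\in[0,\infty)$ and $P^*\in H^{\mathrm{eff}}$ with $P^*\ll Q_a$ such that $$\varepsilon^{(\alpha,h)}=\min\left\{\left(\lambda^*\frac{dP^*}{dQ_a}\right)^{-1/(1-h)},\ \frac{1}{\alpha}\right\},\quad Q_a\text{-a.s.},$$ and $\lambda^*\left(1-\mathrm{E}^{P^*}[\varepsilon^{(\alpha,h)}]\right)=0$. Whenever these statements hold, $\varepsilon^{(\alpha,h)}>0$, $Q_a$-almost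 surely.
   Context: Conventions: $1/0=\infty$, $0^r=\infty$ for $r<0$, and $0\times\infty=0$. $\mathrm{E}^\mu[f]=\int f\,d\mu$ for any nonnegative measure $\mu$; Radon--Nikodym derivatives are taken $[0,\infty)$-valued. Power utility: $U_h(z)=(z^h-1)/h$ for $h\ne 0$ and $U_0(z)=\log(z)$, $z\in[0,\infty]$ (extended-real values by the usual limits at $0$ and $\infty$). Capped power utility: $U_{\alpha,h}(z)=U_h(\min(z,1/\alpha))$ for $\alpha\in[0,1]$. An event is $H$-negligible if it has probability zero under every $P\in H$. The generalized Lebesgue decomposition of $Q$ with respect to $H$ is $Q=Q_a+Q_s$, where the nonnegative measure $Q_s$ is concentrated on an $H$-negligible event and the nonnegative measure $Q_a$ assigns zero mass to every $H$-negligible event. The class of valid e-values for $H$ is $\mathcal{E}(H)=\{\varepsilon:\mathcal{X}\to[0,\infty]\ \text{measurable}: \mathrm{E}^P[\varepsilon]\le 1\ \text{for all } P\in H\}$. With $M_+$ the collection of nonnegative measures on $\mathcal{X}$, the effective hypothesis is $H^{\mathrm{eff}}=\{P\in M_+: \mathrm{E}^P[\varepsilon]\le 1\ \text{for all } \varepsilon\in\mathcal{E}(H)\}$. For measurable $U:[0,\infty]\to[-\infty,\infty]$, a valid e-value $\varepsilon^*\in\mathcal{E}(H)$ is $U$-optimal (against $Q_a$) if, for every $\varepsilon\in\mathcal{E}(H)$, $\mathrm{E}^{Q_a}[U(\varepsilon^* )-U(\varepsilon)]$ is well-defined and $\ge 0$. Here ''well-defined'' means that the integrand avoids an ambiguous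 $\infty-\infty$ $Q_a$-almost surely, and that its positive part or its negative part has finite $Q_a$-expectation. *)

(* Defs.v *)
From mathcomp Require Import all_boot all_order all_algebra.
From mathcomp Require Import all_classical all_reals all_analysis.
From mathcomp Require Import measurable_realfun.

Set Implicit Arguments.
Unset Strict Implicit.
Unset Printing Implicit Defensive.

Import Order.TTheory GRing.Theory Num.Theory.
Import numFieldNormedType.Exports.

Local Open Scope classical_set_scope.
Local Open Scope ring_scope.
Local Open Scope ereal_scope.

(* Power of z in [0, +oo] with 0 ^ r = +oo and +oo ^ r = 0 for r < 0.
   Pitfall: poweR itself has 0 `^ r = 0 and +oo `^ r = +oo for every r != 0,
   whereas inve 0 = +oo and inve +oo = 0. *)
Definition epow (R : realType) (z : \bar R) (r : R) : \bar R :=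
  if (r < 0)%R then (poweR z (- r))^-1 else poweR z r.

(* The arithmetic of \bar R yields the limits at 0 and +oo:
   -1/h and +oo for h > 0, -oo and -1/h for h < 0, -oo and +oo for h = 0. *)
Definition power_utility (R : realType) (h : R) (z : \bar R) : \bar R :=
  if h == 0%R then lne z else (epow z h - 1) * (h^-1)%:E.

(* inve 0 = +oo, so there is no cap when alpha = 0. *)
Definition capped_power_utility (R : realType) (alpha h : R) (z : \bar R) :
    \bar R :=
  power_utility h (mine z (alpha%:E)^-1).

Definition hyp_negligible (d : measure_display) (T : measurableType d)
    (R : realType) (H : set (probability T R)) (N : set T) : Prop :=
  measurable N /\ forall P : probability T R, H P -> P N = 0.

Definition generalized_lebesgue_decomposition (d : measure_display)
    (T : measurableType d) (R : realType) (H : set (probability T R))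
    (Q : probability T R) (Qa Qs : {measure set T -> \bar R}) : Prop :=
  [/\ forall A, measurable A -> Q A = Qa A + Qs A,
      exists N, hyp_negligible H N /\ Qs (~` N) = 0
    & forall N, hyp_negligible H N -> Qa N = 0].

Definition valid_evalue (d : measure_display) (T : measurableType d)
    (R : realType) (H : set (probability T R)) (e : T -> \bar R) : Prop :=
  [/\ measurable_fun setT e,
      forall x, 0 <= e x
    & forall P : probability T R, H P -> \int[P]_x e x <= 1].

Definition effective_hypothesis (d : measure_display) (T : measurableType d)
    (R : realType) (H : set (probability T R)) :
    set {measure set T -> \bar R} :=
  [set P : {measure set T -> \bar R} |
    forall e, valid_evalue H e -> \int[P]_x e x <= 1].

(* The library's 'd P '/d mu is a function of a charge, hence available only
   for finite P, and is nonnegative only almost everywhere; here P is an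
   arbitrary measure and the version f takes values in [0, +oo[. *)
Definition is_radon_nikodym_derivative (d : measure_display)
    (T : measurableType d) (R : realType) (P mu : {measure set T -> \bar R})
    (f : T -> R) : Prop :=
  [/\ measurable_fun setT f,
      forall x, (0 <= f x)%R
    & forall A, measurable A -> P A = \int[mu]_(x in A) (f x)%:E].

(* U matters only on [0, +oo]. The first two clauses say that the expectation
   is well-defined; they are needed because \bar R totalizes
   +oo - +oo to -oo, both pointwise and in the definition of \int. *)
Definition utility_optimal (d : measure_display) (T : measurableType d)
    (R : realType) (H : set (probability T R)) (Qa : {measure set T -> \bar R})
    (U : \bar R -> \bar R) (estar : T -> \bar R) : Prop :=
  valid_evalue H estar /\
  forall e, valid_evalue H e ->
    let D := fun x => U (estar x) - U (e x) in
    [/\ {ae Qa, forall x, U (estar x) +? - U (e x)},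
        \int[Qa]_x D^\+ x < +oo \/ \int[Qa]_x D^\- x < +oo
      & 0 <= \int[Qa]_x D x].

(* Main.v *)
From HB Require Import structures.
Require Import Defs.
From mathcomp Require Import all_boot all_order all_algebra.
From mathcomp Require Import all_classical all_reals all_analysis.
From mathcomp Require Import measurable_realfun ring lra.

Import Order.TTheory GRing.Theory Num.Theory.
Import numFieldNormedType.Exports.

Local Open Scope classical_set_scope.
Local Open Scope ring_scope.

(** Why the statements are equivalent.

    Write s for the (real) values of estar and w = s ^ (h - 1) for the marginal
    utility at s.  Each of the three statements is equivalent to one first-order
    condition, [first_order]: s > 0 almost surely, E[s ^ h] is finite, and
    E[w u] <= E[s ^ h] = E[w s] for every capped e-value u, all expectations
    being under Qa.  Only real-valued e-values matter, because a valid e-value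
    is infinite on a null set of every P in H, hence on a Qa-null set
    ([valid_evalue_ae_fine]).

    Utility is concave, so everything rests on the tangent inequality
    U(x) - U(y) >= x ^ (h - 1) (x - y) ([power_utility_tangent]).  Used at
    x = s it shows that the first-order condition implies optimality.  For the
    converse it is used at the points z = (1 - t) s + t u of the segment from s
    to a competitor u: optimality against z yields
    E[z ^ (h - 1) u] <= E[z ^ (h - 1) s] <= (1 - t) ^ (h - 1) E[s ^ h], and t
    tends to 0 by monotone convergence.  Taking u = 1 in the same bound shows
    s > 0, since the marginal utility explodes at 0.  The finiteness of E[s ^ h]
    comes from comparison with the e-value 1 if h < 0, is trivial if h = 0, and
    if h > 0 comes from the cap or, when alpha = 0, from the assumption.  The variational statement is the
    first-order condition with the difference of the two sides written under
    one integral; the test e-values 0 and 1 recover its first two clauses.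

    Suppose lambda and P with density f are as in the third statement.
    Pointwise, either w = lambda f, or s is at the cap and w >= lambda f; in
    both cases w (u - s) <= lambda f (u - s) for capped u, and integrating
    against the constraint E^P[u] <= 1 and the complementary slackness
    E^P[s] = 1 (unless lambda = 0) gives the first-order condition
    ([multiplier_first_order]).

    The converse ([first_order_multiplier]) is the duality step.  If the cap is
    never reached, f is proportional to w.  In general the first-order condition
    only controls capped e-values, and the density has to be lowered on the set
    A where s equals the cap kappa.  Perturbing s towards an arbitrary nonnegative
    function e with E^P[e] <= t on H, and truncating at the cap, gives
      E[w e; not A] - t E[w s; not A] <= E[w (t kappa - e)^+; A]
    ([directional]).  The right-hand side is sublinear in t kappa - e and the
    left-hand side is linear on the convex cone of these pairs, so the
    Hahn-Banach theorem in the form [sandwich] inserts a linear functional in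
    between.  Being dominated by f |-> E[w f^+; A], this functional is
    countably additive and has a density v with 0 <= v <= w on A and v = 0
    elsewhere ([dominated_functional_density]).  The function k equal to w off A
    and to v on A satisfies E[k u] <= E[k s] for all e-values u, capped or not
    ([multiplier_exists]), and lambda = E[k s], f = k / lambda solve the third
    statement. *)

Set Implicit Arguments.
Unset Strict Implicit.
Unset Printing Implicit Defensive.

(** * A Hahn-Banach sandwich theorem *)

Section sandwich.
Context (R : realType) (V : lmodType R) (S : set V).
Hypothesis S0 : S 0.
Hypothesis SD : forall x y, S x -> S y -> S (x + y).
Hypothesis SZ : forall (t : R) x, S x -> S (t *: x).
Implicit Types (p q : V -> R) (K : set (V * R)).

Definition sublinear_on q : Prop :=
  (forall x y, S x -> S y -> q (x + y) <= q x + q y) /\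
  (forall (t : R) x, 0 <= t -> S x -> q (t *: x) <= t * q x).

(** A convex cone of constraints [u.2 <= G u.1] that the sublinear functional
    [q] already satisfies; the goal is to satisfy them by a linear [G <= q]. *)
Definition cone_below q K : Prop :=
  [/\ K (0, 0),
      forall u v, K u -> K v -> K (u.1 + v.1, u.2 + v.2),
      forall (t : R) u, 0 <= t -> K u -> K (t *: u.1, t * u.2)
    & forall u, K u -> S u.1 /\ u.2 <= q u.1].

Let SN x : S x -> S (- x).
Proof. by move=> Sx; rewrite -scaleN1r; exact: SZ. Qed.

Lemma sublinear_on0 q : sublinear_on q -> q 0 = 0.
Proof.
move=> [qD qZ]; apply/eqP; rewrite eq_le; apply/andP; split.
  by have := qZ 0 0 (lexx _) S0; rewrite scale0r mul0r.
by have := qD 0 0 S0 S0; rewrite addr0 -[X in X <= _]addr0 lerD2l.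
Qed.

Lemma sublinear_onN q x : sublinear_on q -> S x -> - q (- x) <= q x.
Proof.
move=> sq Sx; have := sq.1 _ _ Sx (SN Sx).
by rewrite subrr sublinear_on0// => ?; lra.
Qed.

Lemma sublinear_onZ q (t : R) x :
  sublinear_on q -> 0 <= t -> S x -> q (t *: x) = t * q x.
Proof.
move=> sq t0 Sx; apply/eqP; rewrite eq_le sq.2//=.
have [->|tN0] := eqVneq t 0; first by rewrite scale0r mul0r sublinear_on0.
have tp : 0 < t by rewrite lt0r tN0.
have := sq.2 t^-1 (t *: x); rewrite invr_ge0 => /(_ t0 (SZ t Sx)).
by rewrite scalerA mulVf// scale1r mulrC ler_pdivlMr// mulrC.
Qed.

(** The largest sublinear functional below [q] whose linear minorants satisfy
    all the constraints in [K]. *)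
Definition cone_relaxation q K (y : V) : R :=
  inf [set q (y + u.1) - u.2 | u in K].

Section relaxation.
Context q K (sq : sublinear_on q) (Kq : cone_below q K).

Let val_lb y : S y ->
  lbound [set q (y + u.1) - u.2 | u in K] (- q (- y)).
Proof.
move=> Sy _ [u Ku <-]; have [_ _ _ /(_ _ Ku)[Su uq]] := Kq.
have := sq.1 (y + u.1) (- y) (SD Sy Su) (SN Sy).
by rewrite addrAC subrr add0r => ?; lra.
Qed.

Let relaxation_le_val y u : S y -> K u -> cone_relaxation q K y <= q (y + u.1) - u.2.
Proof.
move=> Sy Ku; apply: ge_inf; last by exists u.
by exists (- q (- y)); exact: val_lb.
Qed.

Let le_relaxation y c : (forall u, K u -> c <= q (y + u.1) - u.2) ->
  c <= cone_relaxation q K y.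
Proof.
move=> H; apply: lb_le_inf; last by move=> _ [u Ku <-]; exact: H.
by have [K0 _ _ _] := Kq; exists (q (y + 0) - 0), (0, 0).
Qed.

Lemma cone_relaxation_le y : S y -> cone_relaxation q K y <= q y.
Proof.
move=> Sy; have [K0 _ _ _] := Kq.
by have := relaxation_le_val Sy K0; rewrite /= addr0 subr0.
Qed.

(** A linear [G] below the relaxation has [- G u.1 = G (- u.1) <= - u.2], which
    is the constraint [u]. *)
Lemma cone_relaxationN u : K u -> cone_relaxation q K (- u.1) <= - u.2.
Proof.
move=> Ku; have [_ _ _ /(_ _ Ku)[Su _]] := Kq.
have := relaxation_le_val (SN Su) Ku.
by rewrite addNr sublinear_on0// sub0r.
Qed.

Lemma cone_relaxation_sublinear : sublinear_on (cone_relaxation q K).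
Proof.
have [K0 KD KZ KS] := Kq; split=> [x y Sx Sy|t x t0 Sx].
  rewrite -lerBlDr; apply: le_relaxation => u Ku.
  rewrite lerBlDr [leRHS]addrC -lerBlDr; apply: le_relaxation => v Kv.
  have := relaxation_le_val (SD Sx Sy) (KD _ _ Ku Kv).
  have := sq.1 (x + u.1) (y + v.1) (SD Sx (KS _ Ku).1) (SD Sy (KS _ Kv).1).
  by rewrite addrACA /= => ? ?; lra.
have [->|tN0] := eqVneq t 0.
  rewrite scale0r mul0r; have := relaxation_le_val S0 K0.
  by rewrite /= addr0 subr0 (@sublinear_on0 q).
have tp : 0 < t by rewrite lt0r tN0.
rewrite mulrC -ler_pdivrMr//; apply: le_relaxation => u Ku.
rewrite ler_pdivrMr// (le_trans (relaxation_le_val (SZ t Sx) (KZ t _ t0 Ku)))//=.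
by rewrite -scalerDr sublinear_onZ//; [lra|exact: SD Sx (KS _ Ku).1].
Qed.

End relaxation.

(** Zorn's lemma applies because the infimum of a chain of sublinear functionals
    is sublinear: two members of the chain can be replaced by the smaller one,
    and [x |-> - p (- x)] bounds the chain from below. *)
Lemma minimal_sublinear p : sublinear_on p ->
  exists q, [/\ sublinear_on q, forall x, S x -> q x <= p x &
    forall r, sublinear_on r -> (forall x, S x -> r x <= q x) ->
      forall x, S x -> q x <= r x].
Proof.
move=> sp.
pose T := {q : V -> R | sublinear_on q /\ forall x, S x -> q x <= p x}.
pose le (q r : T) := `[< forall x, S x -> sval r x <= sval q x >].
have t0 : T by exists p; split.
have lexx (q : T) : le q q by apply/asboolP.
have letr (q r s : T) : le q r -> le r s -> le q s.
  move=> /asboolP qr /asboolP rs; apply/asboolP => x Sx.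
  exact: le_trans (rs x Sx) (qr x Sx).
have [A totA|q qmax] := @ZL_preorder T t0 le lexx letr.
  have [->|/set0P[q0 Aq0]] := eqVneq A set0; first by exists t0.
  pose I x := [set sval q x | q in A].
  pose m x := inf (I x).
  have Ilb x : S x -> has_lbound (I x).
    move=> Sx; exists (- p (- x)) => _ [q _ <-].
    have [sq qp] := svalP q.
    apply: le_trans (sublinear_onN sq Sx).
    by rewrite lerN2; exact: qp (SN Sx).
  have m_le (q : T) x : S x -> A q -> m x <= sval q x.
    by move=> Sx Aq; apply: ge_inf; [exact: Ilb|exists q].
  have le_m c x : (forall q : T, A q -> c <= sval q x) -> c <= m x.
    move=> H; apply: lb_le_inf; first by exists (sval q0 x), q0.
    by move=> _ [q Aq <-]; exact: H.
  have sm : sublinear_on m.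
    split=> [x y Sx Sy|t x t0' Sx].
      rewrite -lerBlDr; apply: (le_m) => q Aq.
      rewrite lerBlDr [leRHS]addrC -lerBlDr; apply: (le_m) => r Ar.
      have [s [As sq sr]] : exists s, [/\ A s, sval s x <= sval q x &
          sval s y <= sval r y].
        have [/asboolP qr|/asboolP rq] := totA _ _ Aq Ar.
          by exists r; split=> //; exact: qr.
        by exists q; split=> //; exact: rq.
      have := m_le s _ (SD Sx Sy) As.
      by have := (svalP s).1.1 _ _ Sx Sy; lra.
    have [->|tN0] := eqVneq t 0.
      rewrite scale0r mul0r (le_trans (m_le _ _ S0 Aq0))//.
      by rewrite sublinear_on0//; exact: (svalP q0).1.
    have tp : 0 < t by rewrite lt0r tN0.
    rewrite mulrC -ler_pdivrMr//; apply: (le_m) => q Aq.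
    rewrite ler_pdivrMr// (le_trans (m_le _ _ (SZ t Sx) Aq))// mulrC.
    exact: (svalP q).1.2.
  have mp x : S x -> m x <= p x.
    by move=> Sx; exact: le_trans (m_le _ _ Sx Aq0) ((svalP q0).2 _ Sx).
  exists (exist _ m (conj sm mp)) => s As; apply/asboolP => x Sx.
  exact: m_le.
have [sq qp] := svalP q; exists (sval q); split=> // r sr rq.
have rp x : S x -> r x <= p x.
  by move=> Sx; exact: le_trans (rq _ Sx) (qp _ Sx).
have /asboolP : le (exist _ r (conj sr rp)) q by apply: qmax; apply/asboolP.
by [].
Qed.

(** The functional [G] is a minimal sublinear functional below the relaxation of
    [p] by [K].  It is linear: relaxing [G] further by the constraint that
    [v] be sent to at least [G v] would give a smaller sublinear functional, so
    by minimality that constraint already holds, that is, [G (- v) = - G v]. *)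
Lemma sandwich p K : sublinear_on p -> cone_below p K ->
  exists G : V -> R,
    [/\ forall x y, S x -> S y -> G (x + y) = G x + G y,
        forall (t : R) x, S x -> G (t *: x) = t * G x,
        forall x, S x -> G x <= p x
      & forall u, K u -> u.2 <= G u.1].
Proof.
move=> sp Kp; have [G [sG Gp Gmin]] :=
  minimal_sublinear (cone_relaxation_sublinear sp Kp).
have GN v : S v -> G (- v) = - G v.
  move=> Sv; pose L := [set u | exists2 t : R, 0 <= t & u = (t *: v, t * G v)].
  have LG : cone_below G L.
    split; first by exists 0; rewrite // scale0r mul0r.
    - move=> _ _ [t t0 ->] [s s0 ->] /=; exists (t + s); first exact: addr_ge0.
      by rewrite scalerDl mulrDl.
    - move=> t _ t0 [s s0 ->] /=; exists (t * s); first exact: mulr_ge0.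
      by rewrite scalerA mulrA.
    - by move=> _ [t t0 ->] /=; rewrite sublinear_onZ//; split=> //; exact: SZ.
  have Lv : L (v, G v) by exists 1; rewrite // scale1r mul1r.
  have := Gmin _ (cone_relaxation_sublinear sG LG)
    (cone_relaxation_le sG LG) _ (SN Sv).
  have := cone_relaxationN sG LG Lv.
  by have := sublinear_onN sG Sv => /=; lra.
have GD x y : S x -> S y -> G (x + y) = G x + G y.
  move=> Sx Sy; have := sG.1 _ _ Sx Sy.
  have := sG.1 _ _ (SD Sx Sy) (SN Sy).
  by rewrite addrK GN//; lra.
exists G; split=> //.
- move=> t x Sx; have [t0|t0] := leP 0 t; first exact: sublinear_onZ.
  rewrite -[t]opprK scaleNr GN; last exact: SZ.
  by rewrite sublinear_onZ//; lra.
- by move=> x Sx; exact: le_trans (Gp _ Sx) (cone_relaxation_le sp Kp Sx).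
- move=> u Ku; have [_ _ _ /(_ _ Ku)[Su _]] := Kp.
  have := Gp _ (SN Su); have := cone_relaxationN sp Kp Ku.
  by rewrite GN//; lra.
Qed.

End sandwich.

(** * Measures with densities *)

Section density.
Local Open Scope ereal_scope.
Context d (X : measurableType d) (R : realType).
Import HBNNSimple.

Lemma density_measure_exists (mu : {measure set X -> \bar R}) (f : X -> R) :
  measurable_fun setT f -> (forall x, 0 <= f x)%R ->
  exists P : {measure set X -> \bar R}, is_radon_nikodym_derivative P mu f.
Proof.
move=> mf f0; pose nu A := \int[mu]_(x in A) (f x)%:E.
have nu0 : nu set0 = 0 by rewrite /nu integral_set0.
have nu_ge0 A : 0 <= nu A by apply: integral_ge0 => x _; rewrite lee_fin.
have nu_sigma : semi_sigma_additive nu.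
  move=> F mF tF mUF; rewrite /nu ge0_integral_bigcup//.
  - apply: is_cvg_nneseries => n _ _; exact: nu_ge0.
  - by apply/measurable_EFinP; exact: measurable_funTS.
  - by move=> x _; rewrite lee_fin.
pose M := isMeasure.Build d X R nu nu0 nu_ge0 nu_sigma.
by exists (HB.pack_for (Measure.type X R) nu M); split.
Qed.

Lemma finite_measure_of (mu : {measure set X -> \bar R}) : mu setT < +oo ->
  exists nu : {finite_measure set X -> \bar R},
    (nu : set X -> \bar R) = (mu : set X -> \bar R).
Proof.
move=> mufin.
have fin : fin_num_fun (mu : set X -> \bar R).
  move=> A mA; rewrite ge0_fin_numE// (le_lt_trans _ mufin)//.
  by apply: le_measure; rewrite ?inE.
have S : sigma_finite setT mu.
  by apply: fin_num_fun_sigma_finite; [rewrite measure0|exact: fin].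
have F : sfinite_measure mu by exact: sfinite_measure_sigma_finite.
pose nu := HB.pack_for (FiniteMeasure.type X R) (Measure.sort mu)
  (isSFinite.Build _ _ _ _ F) (isSigmaFinite.Build _ _ _ _ S)
  (isFinite.Build _ X R mu fin).
by exists nu.
Qed.

(** The identity holds for indicators by definition, and passes to the simple
    functions that approximate [e] from below and to their limit. *)
Lemma integral_density (P mu : {measure set X -> \bar R}) (f : X -> R)
    (e : X -> \bar R) :
  is_radon_nikodym_derivative P mu f ->
  measurable_fun setT e -> (forall x, 0 <= e x) ->
  \int[P]_x e x = \int[mu]_x ((f x)%:E * e x).
Proof.
move=> [mf f0 Pf] me e0.
pose g := nnsfun_approx measurableT me.
have geq x : (g n x)%:E @[n --> \oo] --> e x.
  by apply: cvg_nnsfun_approx => //.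
have gnd x : nondecreasing_seq (fun n => (g n x)%:E).
  by move=> m n mn; rewrite lee_fin; exact/lefP/nd_nnsfun_approx.
have mfE : measurable_fun setT (EFin \o f) by exact/measurable_EFinP.
have mg n : measurable_fun setT (EFin \o g n) by exact/measurable_EFinP.
have lime x : e x = limn (fun n => (g n x)%:E) by apply/esym/cvg_lim.
have limfe x : (f x)%:E * e x = limn (fun n => (f x)%:E * (g n x)%:E).
  by apply/esym/cvg_lim => //; apply: cvgeZl.
under eq_integral do rewrite lime.
under [RHS]eq_integral do rewrite limfe.
rewrite monotone_convergence//; last by move=> n x _; rewrite lee_fin fun_ge0.
rewrite monotone_convergence//; last 3 first.
- by move=> n; apply: emeasurable_funM; [exact: mfE|exact: mg].
- by move=> n x _; rewrite mule_ge0 ?lee_fin ?fun_ge0.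
- by move=> x _ m n mn; rewrite lee_wpmul2l ?lee_fin//; have := gnd x _ _ mn.
congr (limn _); apply/funext => n.
rewrite integralT_nnsfun sintegralE.
transitivity (\int[mu]_x (\sum_(y \in range (g n))
    (f x * (y * \1_(g n @^-1` [set y]) x))%:E)); last first.
  apply: eq_integral => x _; rewrite [in RHS](fimfunE (g n)) -EFinM.
  rewrite mulr_fsumr// fsumEFin//.
have yge0 y : range (g n) y -> (0 <= y)%R by move=> [x _ <-].
rewrite ge0_integral_fsum//; last 2 first.
- move=> y; apply/measurable_EFinP; apply: measurable_funM => //.
  by apply: measurable_funM => //.
- move=> y x _; rewrite lee_fin mulr_ge0// -lee_fin EFinM.
  exact: nnfun_muleindic_ge0.
apply: eq_fsbigr => y /set_mem yr.
have my : measurable (g n @^-1` [set y]) by [].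
under eq_integral do rewrite mulrCA EFinM.
rewrite ge0_integralZl//; last 3 first.
- by apply/measurable_EFinP/measurable_funM.
- by move=> x _; rewrite lee_fin mulr_ge0.
- by rewrite lee_fin yge0.
congr (_ * _); rewrite Pf// [LHS]integral_mkcond.
by apply: eq_integral => x _; rewrite epatch_indic/= EFinM.
Qed.

End density.

(** * Representation of dominated linear functionals *)

Section dominated_functional.
Context d (X : measurableType d) (R : realType).

Definition bounded_measurable : set (X -> R) :=
  [set phi : X -> R | measurable_fun setT phi /\ exists M, forall x, `|phi x| <= M].

Local Notation S := bounded_measurable.

Lemma bounded_measurable_cst c : S (cst c).
Proof. by split; [exact: measurable_cst|exists `|c|]. Qed.

Lemma bounded_measurableD f g : S f -> S g -> S (f + g).
Proof.
move=> [mf [M fM]] [mg [N gN]]; split; first exact: measurable_funD.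
by exists (M + N) => x; rewrite (le_trans (ler_normD _ _))// lerD.
Qed.

Lemma bounded_measurableZ (t : R) f : S f -> S (t *: f).
Proof.
move=> [mf [M fM]]; split; first exact: measurable_funM.
by exists (`|t| * M) => x; rewrite normrM ler_wpM2l.
Qed.

Lemma bounded_measurable_indic A : measurable A -> S \1_A.
Proof.
move=> mA; split; first exact: measurable_indic.
by exists 1 => x; rewrite indicE; case: (_ \in _); rewrite ?normr1 ?normr0.
Qed.

Context (mu : {measure set X -> \bar R}).

Lemma integrable_bounded_measurable (w : X -> R) phi :
  mu.-integrable setT (EFin \o w) -> S phi ->
  mu.-integrable setT (fun x => (w x * phi x)%:E).
Proof.
move=> iw [mphi [M phiM]]; under eq_fun do rewrite EFinM.
apply: (integrableMl measurableT iw mphi); exists M; split => [|N MN x _]; first exact: num_real.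
exact: le_trans (phiM x) (ltW MN).
Qed.

Context (w : X -> R) (G : (X -> R) -> R).
Hypothesis mu_fin : (mu setT < +oo)%E.
Hypothesis iw : mu.-integrable setT (EFin \o w).
Hypothesis w0 : forall x, 0 <= w x.
Hypothesis GD : forall f g, S f -> S g -> G (f + g) = G f + G g.
Hypothesis GZ : forall (t : R) f, S f -> G (t *: f) = t * G f.
Hypothesis Gw : forall f, S f -> G f <= \int[mu]_x (w x * Num.max (f x) 0).

Let mw : measurable_fun setT w.
Proof. by apply/measurable_EFinP; exact: measurable_int iw. Qed.

Let GB f g : S f -> S g -> G (f - g) = G f - G g.
Proof.
move=> Sf Sg; rewrite -scaleN1r GD ?GZ ?mulN1r//.
exact: bounded_measurableZ.
Qed.

Let G_ge0 f : S f -> (forall x, 0 <= f x) -> 0 <= G f.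
Proof.
move=> Sf f0; rewrite -oppr_le0 -mulN1r -GZ//.
apply: le_trans (Gw (bounded_measurableZ (-1) Sf)) _.
rewrite (@eq_Rintegral _ _ _ _ _ (cst 0)); last first.
  move=> x _; rewrite (_ : Num.max _ _ = 0) ?mulr0//.
  by apply/max_idPr; rewrite scaleN1r oppr_le0.
by rewrite Rintegral_cst// mul0r.
Qed.

Let G_le f g : S f -> S g -> (forall x, f x <= g x) -> G f <= G g.
Proof.
move=> Sf Sg fg; rewrite -subr_ge0 -GB//; apply: G_ge0.
  by rewrite -scaleN1r; apply: bounded_measurableD => //; exact: bounded_measurableZ.
by move=> x; rewrite subr_ge0.
Qed.

Let g (A : set X) := G \1_A.

Let gU A B : measurable A -> measurable B -> [disjoint A & B] ->
  g (A `|` B) = g A + g B.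
Proof.
move=> mA mB AB; rewrite /g -GD; try exact: bounded_measurable_indic.
congr G; apply/funext => x; rewrite addrfctE !indicE in_setU.
have [xA|xA] := boolP (x \in A); last by rewrite /= add0r.
rewrite (_ : x \in B = false) ?addr0//; apply/negbTE/negP => xB.
move: AB; rewrite disj_set2E => /eqP AB0.
suff : (A `&` B) x by rewrite AB0.
by split; apply/set_mem.
Qed.

Let g_ge0 A : measurable A -> 0 <= g A.
Proof. by move=> mA; apply: G_ge0 => //; exact: bounded_measurable_indic. Qed.

Let g_le A : measurable A -> g A <= \int[mu]_(x in A) w x.
Proof.
move=> mA; apply: le_trans (Gw (bounded_measurable_indic mA)) _.
rewrite le_eqVlt; apply/orP; left; apply/eqP.
rewrite [RHS]Rintegral_mkcond; apply: eq_Rintegral => x _.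
rewrite patch_indic/=; congr (_ * _).
by apply/max_idPl; rewrite indicE.
Qed.

(* The maximum with 0 matters on non-measurable sets only, where [G \1_A] is
   arbitrary while a measure has to be nonnegative on all sets. *)
Let nu (A : set X) : \bar R := (Num.max 0 (g A))%:E.

Let nuE A : measurable A -> nu A = (g A)%:E.
Proof. by move=> mA; rewrite /nu; congr EFin; apply/max_idPr; exact: g_ge0. Qed.

Let g_set0 : g set0 = 0.
Proof.
rewrite /g indic0 -[cst 0](scale0r (cst 0 : X -> R)) GZ ?mul0r//.
exact: bounded_measurable_cst.
Qed.

Let nu0 : nu set0 = 0%E.
Proof. by rewrite nuE// g_set0. Qed.

Let nu_ge0 A : (0 <= nu A)%E.
Proof. by rewrite lee_fin le_max lexx. Qed.

Let g_bigsetU (F : (set X)^nat) n : (forall i, measurable (F i)) ->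
  trivIset setT F -> g (\big[setU/set0]_(i < n) F i) = \sum_(i < n) g (F i).
Proof.
move=> mF tF; elim: n => [|n ih]; first by rewrite !big_ord0.
rewrite !big_ord_recr/= gU ?ih//; first exact: bigsetU_measurable.
rewrite disj_set2E; apply/eqP.
by apply: (@trivIset_bigsetUI _ predT) => //; rewrite /predT /= trueE.
Qed.

(* Countable additivity is inherited from [w mu]: the defect of [nu] on the first
   [n] sets is the value of [nu] on the remaining ones, which is at most their
   [w mu]-measure. *)
Let nu_sigma : semi_sigma_additive nu.
Proof.
move=> F mF tF mU; rewrite nuE//.
have [m [mw' m0 mE]] := density_measure_exists mu mw w0.
have mfin A : measurable A -> m A \is a fin_num.
  move=> mA; rewrite mE//; apply: integrable_fin_num => //.
  exact: integrableS iw.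
have mR A : measurable A -> m A = (\int[mu]_(x in A) w x)%:E.
  by move=> mA; rewrite -[LHS]fineK ?mfin// mE.
pose U := \bigcup_i F i; pose Un n := \big[setU/set0]_(i < n) F i.
have mUn n : measurable (Un n) by exact: bigsetU_measurable.
have UnU n : Un n `<=` U.
  by rewrite /Un -bigcup_mkord => x [i _ Fix]; exists i.
have cm : fine (m (Un n)) @[n --> \oo] --> fine (m U).
  apply: fine_cvg; rewrite fineK ?mfin//.
  rewrite (_ : (fun n => _) = (fun n => \sum_(0 <= i < n) m (F i))%E).
    exact: measure_semi_sigma_additive.
  by apply/funext => n; rewrite big_mkord measure_semi_additive//; exact: mUn.
have gcvg : g (Un n) @[n --> \oo] --> g U.
  apply: (@squeeze_cvgr _ _ _ _ (fun n => g U - (fine (m U) - fine (m (Un n))))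
    (cst (g U))); last 2 first.
  - rewrite -[X in _ --> X]subr0 -[X in _ - X](subrr (fine (m U))).
    by apply: cvgB; [exact: cvg_cst|apply: cvgB; [exact: cvg_cst|exact: cm]].
  - exact: cvg_cst.
  apply: nearW => n.
  have mD : measurable (U `\` Un n) by exact: measurableD.
  have dj : [disjoint Un n & U `\` Un n].
    by rewrite disj_set2E setDIK.
  have UE : U = Un n `|` (U `\` Un n) by rewrite setDUK.
  have := gU (mUn n) mD dj; rewrite -UE => ->.
  have mUE : fine (m U) = fine (m (Un n)) + fine (m (U `\` Un n)).
    rewrite {1}UE measureU//; last by apply/eqP; rewrite -disj_set2E.
    by rewrite fineD ?mfin.
  have mDE : fine (m (U `\` Un n)) = \int[mu]_(x in U `\` Un n) w x by rewrite mR.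
  have := g_ge0 mD; have := g_le mD => ? ?.
  by rewrite /cst; apply/andP; split; lra.
rewrite (_ : (fun n => _) = EFin \o (fun n => g (Un n))); last first.
  apply/funext => n /=; rewrite g_bigsetU// big_mkord -sumEFin.
  by apply: eq_bigr => i _; rewrite nuE.
by apply: cvg_EFin; [exact: nearW|exact: gcvg].
Qed.

Let nu_measure : {measure set X -> \bar R} :=
  HB.pack_for (Measure.type X R) nu
    (isMeasure.Build d X R nu nu0 nu_ge0 nu_sigma).

Import HBNNSimple.

Let G_sum (I : Type) (r : seq I) (F : I -> X -> R) :
  (forall i, S (F i)) ->
  S (\sum_(i <- r) F i) /\ G (\sum_(i <- r) F i) = \sum_(i <- r) G (F i).
Proof.
move=> SF; elim: r => [|i r [Sr ih]].
  rewrite !big_nil; split; first exact: bounded_measurable_cst.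
  by rewrite -(scale0r (cst 0 : X -> R)) GZ ?mul0r//; exact: bounded_measurable_cst.
by rewrite !big_cons GD// ih; split => //; exact: bounded_measurableD.
Qed.

Let bounded_measurable_nnsfun (f : {nnsfun X >-> R}) : S f.
Proof.
split; first exact: measurable_funPT.
have [M [_ fM]] := simple_bounded f; exists (M + 1) => x.
by apply: fM => //; rewrite ltrDl.
Qed.

Let G_nnsfun (f : {nnsfun X >-> R}) : (G f)%:E = sintegral nu f.
Proof.
rewrite (sintegralE nu_measure).
have fE : (f : X -> R) =
    \sum_(y <- finmap.enum_fset (fset_set (range f))) (y *: \1_(f @^-1` [set y]) : X -> R).
  apply/funext => x; rewrite fimfunE fsbig_finite//=.
  by rewrite fct_sumE.
have Sy (y : R) : S (y *: \1_(f @^-1` [set y])).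
  exact/bounded_measurableZ/bounded_measurable_indic.
have [_ GE] := G_sum (finmap.enum_fset (fset_set (range f))) Sy.
rewrite {1}fE GE.
rewrite fsbig_finite//= -sumEFin; apply: eq_bigr => y _.
rewrite GZ; last exact: bounded_measurable_indic.
by rewrite nuE.
Qed.

Let integral_nu_le f : S f -> (forall x, 0 <= f x) ->
  (\int[nu]_x (f x)%:E <= (G f)%:E)%E.
Proof.
move=> Sf f0; rewrite (ge0_integralTE nu_measure); last first.
  by move=> x; rewrite lee_fin.
apply: ub_ereal_sup => _ [h hf <-]; rewrite -G_nnsfun lee_fin.
by apply: G_le.
Qed.

(** On indicators [G] is a measure between 0 and [w mu], so Radon-Nikodym
    provides [v].  For [f >= 0] bounded the integral is a supremum over simple
    functions, whence [G f >= \int v f] by monotonicity; adding a constant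
    removes the sign condition, and applying this to [- f] gives equality. *)
Lemma dominated_functional_density :
  exists v : X -> R, [/\ measurable_fun setT v,
    forall x, 0 <= v x <= w x
    & forall f, S f -> G f = \int[mu]_x (v x * f x)].
Proof.
have [v [mv v0w nuv]] : exists v : X -> R, [/\ measurable_fun setT v,
    forall x, 0 <= v x <= w x
  & forall A, measurable A -> nu A = (\int[mu]_(x in A) (v x)%:E)%E].
  have [mu' mu'E] := finite_measure_of mu_fin.
  have [nu' nu'E] : exists nu' : {finite_measure set X -> \bar R},
      (nu' : set X -> \bar R) = nu.
    by apply: (@finite_measure_of _ _ _ nu_measure); rewrite /= nuE// ltry.
  have nu_le A : measurable A -> (nu A <= \int[mu]_(x in A) (w x)%:E)%E.
    move=> mA; rewrite nuE// -[leRHS]fineK ?lee_fin; first exact: g_le.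
    by apply: integrable_fin_num => //; exact: integrableS iw.
  have numu : nu' `<< mu'.
    apply/null_content_dominatesP => A mA; rewrite nu'E /= mu'E => muA0.
    apply/eqP; rewrite eq_le nu_ge0 andbT.
    apply: le_trans (nu_le _ mA) _.
    by rewrite null_set_integral//; exact/measurable_funTS/measurable_EFinP.
  have [v1 [v1_ge0 v1_fin iv1 v1E]] := radon_nikodym_sigma_finite numu.
  have {}v1E A : measurable A -> nu A = (\int[mu]_(x in A) v1 x)%E.
    by move=> mA; rewrite -nu'E v1E//= mu'E.
  have {}iv1 : mu.-integrable setT v1 by rewrite -mu'E.
  pose v0 := fine \o v1.
  have v0E x : v1 x = (v0 x)%:E by rewrite /= fineK.
  have iv0 : mu.-integrable setT (EFin \o v0).
    by rewrite (_ : _ \o _ = v1)//; apply/funext => x /=; rewrite -v0E.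
  have v0_ge0 x : 0 <= v0 x by rewrite -lee_fin -v0E.
  have mv0 : measurable_fun setT v0.
    by apply/measurable_EFinP; exact: measurable_int iv0.
  have nuv0 A : measurable A -> nu A = (\int[mu]_(x in A) (v0 x)%:E)%E.
    by move=> mA; rewrite v1E//; apply: eq_integral => x _.
  pose N := [set x | w x < v0 x].
  have mN : measurable N.
    rewrite (_ : N = ~` [set x | v0 x <= w x]).
      by apply: measurableC; rewrite -[X in measurable X]setTI; exact: measurable_fun_le.
    by apply/seteqP; split => x; rewrite /N /= ltNge => /negP.
  have v0w : {ae mu, forall x, v0 x <= w x}.
    have : (\int[mu]_(x in N) `|(v0 x)%:E - (w x)%:E| = 0)%E.
      apply/eqP; rewrite eq_le integral_ge0// andbT.
      rewrite (eq_integral (fun x => (v0 x)%:E - (w x)%:E)%E).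
        rewrite integralB_EFin//; [|exact: integrableS iv0|exact: integrableS iw].
        rewrite leeBlDr; first by rewrite add0e -nuv0//; exact: nu_le.
        by apply: integrable_fin_num => //; exact: integrableS iw.
      move=> x; rewrite inE => Nx; rewrite gee0_abs// -EFinB lee_fin subr_ge0.
      exact: ltW.
    move/ae_eq_integral_abs => /(_ mN) H; have := H _.
    have mB : measurable_fun N (fun x => (v0 x)%:E - (w x)%:E)%E.
      by apply: measurable_funTS; apply: emeasurable_funB; exact/measurable_EFinP.
    move=> /(_ mB); apply: filterS => x; rewrite leNgt => vw.
    by apply/negP => Nx; have := vw Nx; case=> /eqP; rewrite subr_eq0 gt_eqF.
  (* [v0 <= w] holds almost everywhere; the minimum makes it hold everywhere. *)
  exists (fun x => Num.min (v0 x) (w x)); split.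
  - exact: measurable_minr.
  - by move=> x; rewrite le_min v0_ge0 w0/= ge_min lexx orbT.
  - move=> A mA; rewrite nuv0//; apply: ae_eq_integral => //.
    + exact/measurable_funTS/measurable_EFinP.
    + exact/measurable_funTS/measurable_EFinP/measurable_minr.
    + by apply: filterS v0w => x vw _ /=; congr EFin; apply/esym/min_idPl.
have v0 x : 0 <= v x by have /andP[] := v0w x.
have iv : mu.-integrable setT (EFin \o v).
  apply: (le_integrable measurableT _ _ iw); first exact/measurable_EFinP.
  by move=> x _; have /andP[? ?] := v0w x; rewrite /= lee_fin !ger0_norm.
have ivf f : S f -> mu.-integrable setT (fun x => (v x * f x)%:E).
  exact: integrable_bounded_measurable.
have ge0_case f : S f -> (forall x, 0 <= f x) -> \int[mu]_x (v x * f x) <= G f.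
  move=> Sf f0; rewrite -lee_fin; apply: le_trans (integral_nu_le Sf f0).
  have nuvD : is_radon_nikodym_derivative nu_measure mu v by split.
  rewrite (integral_density nuvD).
  - rewrite /Rintegral fineK; first by under [leRHS]eq_integral do rewrite -EFinM.
    by apply: integrable_fin_num => //; exact: ivf.
  - by apply/measurable_EFinP; case: Sf.
  - by move=> x; rewrite lee_fin.
have GT c : G (cst c) = \int[mu]_x (v x * c).
  have -> : cst c = c *: \1_[set: X] :> (X -> R).
    by apply/funext => x; rewrite scalrfctE indicT; exact: esym (mulr1 c).
  rewrite GZ; last exact: bounded_measurable_indic.
  rewrite RintegralZr// mulrC; congr (_ * _).
  by have := nuv _ measurableT; rewrite nuE// /Rintegral => <-.
have le_case f : S f -> \int[mu]_x (v x * f x) <= G f.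
  move=> Sf; have [mf [M fM]] := Sf.
  have SfM : S (f + cst M).
    by apply: bounded_measurableD => //; exact: bounded_measurable_cst.
  have fM0 x : 0 <= (f + cst M) x.
    by have := fM x; rewrite ler_norml => /andP[? _]; rewrite addrfctE /cst; lra.
  have := ge0_case _ SfM fM0; rewrite GD//; last exact: bounded_measurable_cst.
  rewrite (@eq_Rintegral _ _ _ _ _ (fun x => v x * f x + v x * M)); last first.
    by move=> x _; rewrite addrfctE mulrDr.
  rewrite RintegralD//; [|exact: ivf|exact: ivf (bounded_measurable_cst M)].
  by rewrite GT lerD2r.
exists v; split=> // f Sf; apply/eqP; rewrite eq_le le_case// andbT.
have := le_case _ (bounded_measurableZ (-1) Sf); rewrite GZ// mulN1r.
rewrite (@eq_Rintegral _ _ _ _ _ (fun x => - 1 * (v x * f x))); last first.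
  by move=> x _; rewrite mulrCA.
by rewrite RintegralZl// ?mulN1r ?lerN2//; exact: ivf.
Qed.

End dominated_functional.

Section positive_part.
Context d (X : measurableType d) (R : realType) (mu : {measure set X -> \bar R}).
Context (w : X -> R).
Hypothesis iw : mu.-integrable setT (EFin \o w).
Hypothesis w0 : forall x, 0 <= w x.

Local Notation S := (@bounded_measurable d X R).

Lemma bounded_measurable_pos f : S f -> S (fun x => Num.max (f x) 0).
Proof.
move=> [mf [M fM]]; split; first exact: measurable_maxr.
exists M => x; have := fM x; rewrite ler_norml => /andP[Mf fM'].
rewrite ger0_norm ?le_max ?lexx ?orbT// ge_max fM'/=.
exact: le_trans (normr_ge0 _) (fM x).
Qed.

Lemma integral_pos_sublinear :
  sublinear_on S (fun f => \int[mu]_x (w x * Num.max (f x) 0)).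
Proof.
have ip f : S f -> mu.-integrable setT (fun x => (w x * Num.max (f x) 0)%:E).
  by move=> Sf; apply: integrable_bounded_measurable => //; exact: bounded_measurable_pos.
split=> [f g Sf Sg|t f t0 Sf].
  rewrite -RintegralD//; [|exact: ip..].
  apply: le_Rintegral => //; first by apply: ip; exact: bounded_measurableD.
    rewrite (_ : _ \o _ = (fun x => (w x * Num.max (f x) 0)%:E) \+
      (fun x => (w x * Num.max (g x) 0)%:E))%E//.
    by apply: integrableD => //; exact: ip.
  move=> x _; rewrite -mulrDr ler_wpM2l// addrfctE ge_max.
  by rewrite lerD ?le_max ?lexx//= addr_ge0// le_max lexx orbT.
rewrite -RintegralZl//; last exact: ip.
rewrite le_eqVlt; apply/orP; left; apply/eqP; apply: eq_Rintegral => x _.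
rewrite scalrfctE mulrCA; congr (_ * _).
by rewrite maxr_pMr// mulr0.
Qed.

End positive_part.

(** * Concavity of the power utilities *)

Section power_utility.
Context (R : realType).
Implicit Types (h x y u : R).
Local Open Scope ereal_scope.

Lemma powR_antitone (r x y : R) : (r <= 0)%R -> (0 < x)%R -> (x <= y)%R ->
  (y `^ r <= x `^ r)%R.
Proof.
move=> r0 x0 xy; rewrite -[r]opprK !(powRN _ (- r)).
have y0 := lt_le_trans x0 xy.
rewrite lef_pV2 ?posrE ?powR_gt0//.
by apply: ge0_ler_powR; rewrite ?nnegrE ?oppr_ge0// ltW.
Qed.

Lemma epow_EFin x (r : R) : (0 < x)%R -> epow x%:E r = (x `^ r)%:E.
Proof.
move=> x0; rewrite /epow; case: ifPn => // r0.
by rewrite poweR_EFin inver gt_eqF ?powR_gt0// powRN invrK.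
Qed.

Lemma power_utility_EFin h x : (0 < x)%R ->
  power_utility h x%:E =
  (if h == 0%R then ln x else ((x `^ h - 1) / h)%R)%:E.
Proof.
move=> x0; rewrite /power_utility; case: ifPn => h0; first by rewrite lne_EFin.
by rewrite epow_EFin.
Qed.

Lemma power_utility_fin_num h x : (0 < x)%R -> power_utility h x%:E \is a fin_num.
Proof. by move=> x0; rewrite power_utility_EFin. Qed.

Lemma power_utility0_pos h : (0 < h)%R -> power_utility h 0 = (- h^-1)%:E.
Proof.
move=> h0; rewrite /power_utility gt_eqF// /epow ltNge (ltW h0)/=.
by rewrite powR0 ?gt_eqF// -EFinB -EFinM sub0r mulN1r.
Qed.

Lemma power_utility0_npos h : (h <= 0)%R -> power_utility h 0 = -oo.
Proof.
rewrite /power_utility le_eqVlt => /orP[/eqP ->|h0].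
  by rewrite eqxx le0_lneNy.
rewrite lt_eqF// /epow h0 poweR0r ?oppr_eq0 ?lt_eqF// inve0 addye//.
by rewrite lt0_mulye// lte_fin invr_lt0.
Qed.

Lemma power_utility1 h : power_utility h 1 = 0.
Proof.
rewrite power_utility_EFin// ln1 powR1 subrr mul0r.
by case: ifP.
Qed.

(** Weighted sum, with weights [h] and [1 - h], of the tangent lines of [expR] at
    the point [h u], evaluated at [u] and at 0. *)
Lemma expR_tangent h u : (0 <= h <= 1)%R ->
  (expR (h * u) <= 1 + h * (expR u - 1))%R.
Proof.
move=> /andP[h0 h1].
have e0 : (0 <= expR (h * u))%R := expR_ge0 _.
have e1 : (expR (h * u) * (1 + (1 - h) * u) <= expR u)%R.
  rewrite (_ : expR u = expR (h * u) * expR ((1 - h) * u))%R; last first.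
    by rewrite -expRD; congr expR; ring.
  by rewrite ler_wpM2l// expR_ge1Dx.
have e2 : (expR (h * u) * (1 - h * u) <= 1)%R.
  rewrite [leRHS](_ : 1 = expR (h * u) * expR (- (h * u)))%R; last first.
    by rewrite -expRD subrr expR0.
  by rewrite ler_wpM2l// expR_ge1Dx.
have := ler_wpM2l h0 e1.
have h1' : (0 <= 1 - h)%R by rewrite subr_ge0.
have := ler_wpM2l h1' e2; lra.
Qed.

(** With [y = x e^u] the inequality is homogeneous in [x] and becomes a
    comparison of [e^(h u)] with [1 + h (e^u - 1)]. *)
Lemma power_utility_tangent h x y : (h < 1)%R -> (0 < x)%R -> (0 <= y)%R ->
  (x `^ (h - 1) * (x - y))%:E <= power_utility h x%:E - power_utility h y%:E.
Proof.
move=> h1 x0; rewrite le_eqVlt => /orP[/eqP <-|y0].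
  have [h0|h0] := leP h 0%R.
    rewrite power_utility0_npos//= addey ?leey//.
    by have := power_utility_fin_num h x0; rewrite fin_numE => /andP[].
  rewrite power_utility0_pos// power_utility_EFin// gt_eqF//.
  rewrite -EFinB lee_fin subr0 mulrC mulr_powRB1 ?(ltW x0)//.
  rewrite opprK mulrBl mul1r subrK ler_pdivlMr//.
  by rewrite ler_piMr ?powR_ge0// ltW.
rewrite !power_utility_EFin// -EFinB lee_fin.
pose u := ln (y / x).
have yE : y = (x * expR u)%R.
  by rewrite lnK ?posrE ?divr_gt0// mulrCA divff ?gt_eqF// mulr1.
have xE : (x `^ (h - 1) * (x - y) = x `^ h * (1 - expR u))%R.
  rewrite yE (_ : (x - x * expR u)%R = (x * (1 - expR u))%R); last by ring.
  rewrite mulrA; congr (_ * _)%R.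
  rewrite powRB; last by rewrite (gt_eqF x0) implybT.
  by rewrite powRr1 ?(ltW x0)// mulrVK// unitfE gt_eqF.
have yhE : (y `^ h = x `^ h * expR (h * u))%R.
  rewrite yE powRM ?expR_ge0 ?(ltW x0)//; congr (_ * _)%R.
  by rewrite /powR gt_eqF ?expR_gt0// expRK.
have xh0 : (0 <= x `^ h)%R := powR_ge0 _ _.
rewrite xE; case: ifPn => [/eqP h0|h0].
  rewrite h0 powRr0 mul1r yE lnM ?posrE ?expR_gt0// expRK.
  have := expR_ge1Dx u; lra.
rewrite yhE -mulrBl.
have -> : (x `^ h - 1 - (x `^ h * expR (h * u) - 1) =
  x `^ h * (1 - expR (h * u)))%R by ring.
rewrite -mulrA ler_wpM2l//.
have [hp|hn] := ltP 0%R h.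
  rewrite ler_pdivlMr//; have := @expR_tangent h u.
  rewrite (ltW hp) (ltW h1) => /(_ isT); lra.
have {}hn : (h < 0)%R by rewrite lt_neqAle h0.
rewrite ler_ndivlMr//; have := expR_ge1Dx (h * u).
have := expR_ge1Dx u; nra.
Qed.

End power_utility.

(** * Measurability of extended powers and utilities *)

Section measurability.
Context (R : realType).
Local Open Scope ereal_scope.

Lemma measurable_fun_ereal (phi : \bar R -> \bar R) :
  measurable_fun setT (phi \o EFin) -> measurable_fun setT phi.
Proof.
move=> mphi.
rewrite (_ : phi = fun z => if z == +oo then phi +oo else
    if z == -oo then phi -oo else (phi \o EFin) (fine z)); last first.
  by apply/funext; case.
apply: measurable_fun_ifT => //; first exact: measurable_fun_eqe.
apply: measurable_fun_ifT => //; first exact: measurable_fun_eqe.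
exact: (measurableT_comp mphi).
Qed.

Lemma measurable_epow (r : R) : measurable_fun setT (@epow R ^~ r).
Proof.
apply: measurable_fun_ereal; rewrite /epow.
have [r0|r0] := ltP r 0%R; last first.
  by apply/measurable_EFinP; exact: measurable_powR.
rewrite (_ : _ \o _ = fun x : R => if (x `^ (- r))%R == 0%R then +oo
    else ((x `^ (- r))^-1)%:E); last by apply/funext => x /=; rewrite inver.
under eq_fun do rewrite -powRN opprK.
apply: measurable_fun_ifT => //.
  by apply: measurable_fun_eqr => //; exact: measurable_powR.
by apply/measurable_EFinP; exact: measurable_powR.
Qed.

Lemma measurable_lne : measurable_fun setT (@lne R).
Proof.
apply: measurable_fun_ereal.
apply: measurable_fun_ifT => //; first exact: measurable_fun_ler.
by apply/measurable_EFinP; exact: measurable_ln.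
Qed.

Lemma measurable_power_utility (h : R) : measurable_fun setT (power_utility h).
Proof.
rewrite /power_utility; case: (h == 0%R); first exact: measurable_lne.
apply: emeasurable_funM => //; apply: emeasurable_funB => //.
exact: measurable_epow.
Qed.

Lemma measurable_capped_power_utility (alpha h : R) :
  measurable_fun setT (capped_power_utility alpha h).
Proof.
apply: measurableT_comp; first exact: measurable_power_utility.
exact: measurable_mine.
Qed.

End measurability.

(** * Integrals of extended-valued differences *)

Section quasi_integrals.
Context d (X : measurableType d) (R : realType) (mu : {measure set X -> \bar R}).
Local Open Scope ereal_scope.

(** Passing from [0 <= \int D] and [D <= a - b] to [\int b <= \int a] when
    neither [D] nor [b] is known to be integrable: integrate
    [D^+ + b <= a + D^-] and use that [\int D^+] is finite. *)
Lemma integral_le_of_integralB_ge0 (D : X -> \bar R) (a b : X -> R) :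
  measurable_fun setT D -> measurable_fun setT a -> measurable_fun setT b ->
  (forall x, 0 <= a x)%R -> (forall x, 0 <= b x)%R ->
  {ae mu, forall x, D x <= (a x - b x)%:E} ->
  \int[mu]_x (a x)%:E < +oo -> 0 <= \int[mu]_x D x ->
  \int[mu]_x (b x)%:E <= \int[mu]_x (a x)%:E.
Proof.
move=> mD ma mb a0 b0 Dab aoo intD.
have mDp := measurable_funepos mD; have mDn := measurable_funeneg mD.
have mae : measurable_fun setT (EFin \o a) by exact/measurable_EFinP.
have mbe : measurable_fun setT (EFin \o b) by exact/measurable_EFinP.
have Dpa : \int[mu]_x D^\+ x <= \int[mu]_x (a x)%:E.
  apply: ae_ge0_le_integral => //; first by move=> x _; rewrite lee_fin.
  apply: filterS Dab => x Dx _; rewrite funeposE ge_max lee_fin a0 andbT.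
  by rewrite (le_trans Dx)// lee_fin gerBl.
have Dp_fin : \int[mu]_x D^\+ x \is a fin_num.
  by rewrite ge0_fin_numE ?(le_lt_trans Dpa)// integral_ge0.
have DnDp : \int[mu]_x D^\- x <= \int[mu]_x D^\+ x.
  rewrite -sube_ge0; first by rewrite -integralE.
  by rewrite Dp_fin ?orbT.
rewrite -(@leeD2lE _ (\int[mu]_x D^\+ x))// -ge0_integralD//; last by move=> x _; rewrite lee_fin.
apply: (@le_trans _ _ (\int[mu]_x (D^\- x + (a x)%:E))).
  apply: ae_ge0_le_integral => //.
  - by move=> x _; rewrite adde_ge0// lee_fin.
  - exact: emeasurable_funD.
  - by move=> x _; rewrite adde_ge0// lee_fin.
  - exact: emeasurable_funD.
  apply: filterS Dab => x; rewrite funeposE funenegE => + _.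
  case: (D x) => [r rab|//|_].
    rewrite -EFinN -!EFin_max -!EFinD lee_fin; move: rab; rewrite lee_fin => rab.
    by case: (lerP r 0) => ?; case: (lerP (- r)%R 0) => ?; lra.
  by rewrite [maxe (- -oo) _]max_l ?leey// addye ?leey.
rewrite ge0_integralD//; last by move=> x _; rewrite lee_fin.
by rewrite leeD2r.
Qed.

Lemma integral_ge0_of_ge (D : X -> \bar R) (r : X -> R) :
  measurable_fun setT D -> mu.-integrable setT (EFin \o r) ->
  {ae mu, forall x, (r x)%:E <= D x} -> 0 <= \int[mu]_x (r x)%:E ->
  \int[mu]_x D^\- x < +oo /\ 0 <= \int[mu]_x D x.
Proof.
move=> mD ir rD intr.
have mr := measurable_int _ ir.
have Dnr : \int[mu]_x D^\- x <= \int[mu]_x (EFin \o r)^\- x.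
  apply: ae_ge0_le_integral => //; [exact: measurable_funeneg..|].
  apply: filterS rD => x rDx _; rewrite !funenegE.
  by rewrite ge_max !le_max lexx leeN2 rDx ?orbT.
split.
  by apply: (le_lt_trans Dnr); exact: integral_funeneg_lt_pinfty.
rewrite integralE; move: intr; rewrite integralE => /le_trans; apply.
apply: leeB => //.
apply: ae_ge0_le_integral => //; [exact: measurable_funepos..|].
apply: filterS rD => x rDx _; rewrite !funeposE/=.
by rewrite ge_max !le_max lexx rDx orbT.
Qed.

End quasi_integrals.

(** * Valid e-values *)

Section evalues.
Context d (X : measurableType d) (R : realType) (H : set (probability X R)).
Implicit Types (e : X -> \bar R) (u v : X -> R).
Local Open Scope ereal_scope.

Lemma valid_evalue_le e e' : measurable_fun setT e' -> (forall x, 0 <= e' x) ->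
  (forall x, e' x <= e x) -> valid_evalue H e -> valid_evalue H e'.
Proof.
move=> me' e'0 e'e [me e0 He]; split=> // P HP.
by apply: le_trans (He P HP); exact: ge0_le_integral.
Qed.

Lemma valid_evalue_cst (c : R) : (0 <= c <= 1)%R ->
  valid_evalue H (fun=> c%:E).
Proof.
move=> /andP[c0 c1]; split=> [//|x|P HP]; first by rewrite lee_fin.
by rewrite integral_cst//= probability_setT mule1 lee_fin.
Qed.

Lemma valid_evalue_fine e : valid_evalue H e ->
  valid_evalue H (EFin \o (fine \o e)).
Proof.
move=> ve; have [me e0 _] := ve; apply: valid_evalue_le ve.
- by apply/measurable_EFinP; exact: measurableT_comp.
- by move=> x; rewrite lee_fin fine_ge0.
- by move=> x /=; case: (e x) (e0 x) => //= _; rewrite leey.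
Qed.

Lemma valid_evalue_measurable u : valid_evalue H (EFin \o u) ->
  measurable_fun setT u.
Proof. by case=> /measurable_EFinP. Qed.

Lemma valid_evalue_ge0 u : valid_evalue H (EFin \o u) -> forall x, (0 <= u x)%R.
Proof. by case=> _ u0 _ x; rewrite -lee_fin; exact: u0. Qed.

Lemma integral_lincomb (mu : {measure set X -> \bar R}) (a b : R) u v :
  (0 <= a)%R -> (0 <= b)%R ->
  measurable_fun setT u -> measurable_fun setT v ->
  (forall x, 0 <= u x)%R -> (forall x, 0 <= v x)%R ->
  \int[mu]_x (a * u x + b * v x)%:E =
  a%:E * \int[mu]_x (u x)%:E + b%:E * \int[mu]_x (v x)%:E.
Proof.
move=> a0 b0 mu' mv u0 v0.
under eq_integral do rewrite EFinD.
rewrite ge0_integralD//; last 4 first.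
- by move=> x _; rewrite lee_fin mulr_ge0.
- by apply/measurable_EFinP; exact: measurable_funM.
- by move=> x _; rewrite lee_fin mulr_ge0.
- by apply/measurable_EFinP; exact: measurable_funM.
under eq_integral do rewrite EFinM.
under [X in _ + X]eq_integral do rewrite EFinM.
rewrite !ge0_integralZl//; first exact/measurable_EFinP.
- by move=> x _; rewrite lee_fin.
- exact/measurable_EFinP.
- by move=> x _; rewrite lee_fin.
Qed.

Lemma valid_evalue_conv (t : R) u v : (0 <= t <= 1)%R ->
  valid_evalue H (EFin \o u) -> valid_evalue H (EFin \o v) ->
  valid_evalue H (EFin \o (fun x => (1 - t) * u x + t * v x)%R).
Proof.
move=> /andP[t0 t1] vu vv; have t1' : (0 <= 1 - t)%R by rewrite subr_ge0.
have um := valid_evalue_measurable vu; have mv := valid_evalue_measurable vv.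
have u0 := valid_evalue_ge0 vu; have v0 := valid_evalue_ge0 vv.
split => [|x|P HP].
- by apply/measurable_EFinP; apply: measurable_funD; exact: measurable_funM.
- by rewrite lee_fin addr_ge0// mulr_ge0.
rewrite integral_lincomb//.
have [_ _ /(_ P HP) Pu] := vu; have [_ _ /(_ P HP) Pv] := vv.
apply: (@le_trans _ _ ((1 - t)%:E * 1 + t%:E * 1)).
  by apply: leeD; apply: lee_wpmul2l.
by rewrite !mule1 -EFinD subrK.
Qed.

Context (Q : probability X R) (Qa Qs : {measure set X -> \bar R}).
Hypothesis HQ : generalized_lebesgue_decomposition H Q Qa Qs.

Lemma lebesgue_decomposition_fin : Qa setT < +oo.
Proof.
have [/(_ _ measurableT) QE _ _] := HQ.
rewrite (@le_lt_trans _ _ 1) ?ltry// -(@probability_setT _ _ _ Q) QE.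
exact: leeDl.
Qed.

(** The set where [e] is infinite is negligible for [H], hence null for [Qa]. *)
Lemma valid_evalue_ae_lty e : valid_evalue H e ->
  {ae Qa, forall x, e x < +oo}.
Proof.
move=> [me e0 He]; have [_ _ Qa0] := HQ.
pose N := [set x | e x = +oo].
have mN : measurable N.
  by rewrite -[N]setTI; exact: measurable_eqe.
exists N; split=> //; last by move=> x /=; rewrite ltey => /negP; rewrite negbK => /eqP.
apply: Qa0; split=> // P HP.
have iP : P.-integrable setT e.
  apply/integrableP; split => //.
  under eq_integral do rewrite gee0_abs//.
  by rewrite (le_lt_trans (He P HP))// ltry.
apply/measure0_null_setP => //; apply: negligible_null_set.
apply: (negligibleS _ (integrable_ae measurableT iP)).
by move=> x /= -> /(_ I).
Qed.

Lemma valid_evalue_ae_fine e : valid_evalue H e ->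
  {ae Qa, forall x, e x = (fine (e x))%:E}.
Proof.
move=> ve; have [_ e0 _] := ve; apply: filterS (valid_evalue_ae_lty ve) => x ex.
by rewrite fineK// ge0_fin_numE.
Qed.

End evalues.

(** * The first-order condition *)

Section optimality.
Context d (X : measurableType d) (R : realType) (H : set (probability X R)).
Context (Q : probability X R) (Qa Qs : {measure set X -> \bar R}).
Hypothesis HQ : generalized_lebesgue_decomposition H Q Qa Qs.
Context (alpha h : R) (alpha01 : 0 <= alpha <= 1) (h1 : h < 1).
Context (estar : X -> \bar R) (estar_valid : valid_evalue H estar).
Hypothesis estar_cap : forall x, (estar x <= (alpha%:E)^-1)%E.
Local Open Scope ereal_scope.
Implicit Types (u : X -> R).

(* [W] is the marginal utility at [s], and [W s = Z] where [s > 0]. *)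
Local Notation cap := (alpha%:E)^-1.
Local Notation s := (fine \o estar).
Local Notation W := (fun x => (s x `^ (h - 1))%R).
Local Notation Z := (fun x => (s x `^ h)%R).
Local Notation U := (capped_power_utility alpha h).

(** Optimality of [s] in the linearized problem: maximize the expectation of
    [W u] over the capped e-values [u]. *)
Definition first_order : Prop :=
  [/\ {ae Qa, forall x, (0 < s x)%R},
      \int[Qa]_x (Z x)%:E < +oo
    & forall u, valid_evalue H (EFin \o u) -> (forall x, (u x)%:E <= cap) ->
        \int[Qa]_x (W x * u x)%:E <= \int[Qa]_x (Z x)%:E].

Let mestar : measurable_fun setT estar. Proof. by case: estar_valid. Qed.
Let estar0 x : 0 <= estar x. Proof. by case: estar_valid. Qed.
Let ms : measurable_fun setT s. Proof. exact: measurableT_comp. Qed.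
Let s0 x : (0 <= s x)%R. Proof. exact: fine_ge0. Qed.
Let mpow (r : R) (f : X -> R) : measurable_fun setT f ->
  measurable_fun setT (fun x => (f x `^ r)%R).
Proof. by move=> mf; exact: (@measurableT_comp _ _ _ _ _ _ (@powR R ^~ r)). Qed.
Let mZ : measurable_fun setT Z. Proof. exact: mpow. Qed.
Let mW : measurable_fun setT W. Proof. exact: mpow. Qed.

Let cap_ge1 : 1 <= cap.
Proof.
rewrite inver; case: ifPn => [_|a0]; first exact: leey.
by have /andP[a0' a1] := alpha01; rewrite lee_fin invf_ge1// lt0r a0.
Qed.

Let s_cap x : (s x)%:E <= cap.
Proof.
move: (estar_cap x) (estar0 x) => /=; case: (estar x) => [r| |]//= _ _.
by rewrite (le_trans _ cap_ge1).
Qed.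

Let s_valid : valid_evalue H (EFin \o s). Proof. exact: valid_evalue_fine. Qed.

Let estar_fine : {ae Qa, forall x, estar x = (s x)%:E}.
Proof. exact: (valid_evalue_ae_fine HQ). Qed.

Let WsZ x : (0 < s x)%R -> (W x * s x)%R = Z x.
Proof.
move=> sx /=; rewrite powRB; last by rewrite (gt_eqF sx) implybT.
by rewrite powRr1 ?(ltW sx)// mulrVK// unitfE gt_eqF.
Qed.

Let utility_capped z : z <= cap -> U z = power_utility h z.
Proof. by move=> zc; rewrite /capped_power_utility; congr power_utility; apply/min_idPl. Qed.

Let integral_bounded_lty (f : X -> R) (c : R) : (0 <= c)%R ->
  measurable_fun setT f ->
  (forall x, 0 <= f x <= c)%R -> \int[Qa]_x (f x)%:E < +oo.
Proof.
move=> c0 mf fc; apply: (@le_lt_trans _ _ (\int[Qa]_x c%:E)).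
  apply: ge0_le_integral => //.
  - by move=> x _; have /andP[] := fc x; rewrite lee_fin.
  - exact/measurable_EFinP.
  - by move=> x _; have /andP[] := fc x; rewrite lee_fin.
rewrite integral_cst// lte_mul_pinfty//.
exact: (lebesgue_decomposition_fin HQ).
Qed.

(** * Optimality implies the first-order condition *)

Section necessity.
Hypothesis opt : utility_optimal H Qa U estar.
Hypothesis estar_moment : alpha = 0%R -> (0 < h)%R ->
  \int[Qa]_x epow (estar x) h < +oo.

Let optimal_ge0 u : valid_evalue H (EFin \o u) -> (forall x, (u x)%:E <= cap) ->
  exists D : X -> \bar R, [/\ measurable_fun setT D, 0 <= \int[Qa]_x D x &
    {ae Qa, forall x, D x = power_utility h (s x)%:E - power_utility h (u x)%:E}].
Proof.
move=> vu uc; exists (fun x => U (estar x) - U (u x)%:E).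
have [_ /(_ _ vu)[_ _ D0]] := opt; split=> //.
  have mU := measurable_capped_power_utility alpha h.
  apply: emeasurable_funB; apply: (measurableT_comp mU) => //.
  exact/measurable_EFinP/(valid_evalue_measurable vu).
by apply: filterS estar_fine => x ->; rewrite !utility_capped.
Qed.

Let one_valid : valid_evalue H (EFin \o (cst 1%R : X -> R)).
Proof. by apply: valid_evalue_cst; rewrite ler01 lexx. Qed.

(* Only [h < 0] needs optimality: against the e-value 1, of utility 0, it bounds
   the expectation of [(s^h - 1) / h] from below. *)
Let moment_lty : \int[Qa]_x (Z x)%:E < +oo.
Proof.
have Z0 x : (0 <= Z x)%R by exact: powR_ge0.
have [h0|hN0] := leP 0%R h; last first.
  have [D [mD D0 DE]] := optimal_ge0 one_valid (fun=> cap_ge1).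
  pose k := (- h^-1)%R; have k0 : (0 < k)%R by rewrite oppr_gt0 invr_lt0.
  have kfin : \int[Qa]_x k%:E < +oo.
    by apply: (@integral_bounded_lty _ k) => // [|x]; rewrite ?lexx ltW.
  have : \int[Qa]_x (k * Z x)%:E <= \int[Qa]_x k%:E.
    apply: (integral_le_of_integralB_ge0 mD) => //.
    - exact: measurable_funM.
    - by move=> x; exact: ltW.
    - by move=> x; rewrite mulr_ge0// ltW.
    apply: filterS DE => x ->; rewrite power_utility1 sube0.
    move: (s0 x); rewrite le_eqVlt => /orP[/eqP sx|sx].
      by rewrite -sx power_utility0_npos ?leNye// ltW.
    rewrite power_utility_EFin// lt_eqF// lee_fin /k.
    by rewrite le_eqVlt; apply/orP; left; apply/eqP; ring.
  under eq_integral do rewrite EFinM.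
  rewrite ge0_integralZl//; last 3 first.
  - exact/measurable_EFinP.
  - by move=> x _; rewrite lee_fin.
  - by rewrite lee_fin ltW.
  move=> kZ; rewrite ltey; apply/eqP => ZE; move: kZ; rewrite ZE gt0_muley ?lte_fin//.
  by rewrite leye_eq => /eqP kE; rewrite kE in kfin.
have [a0|aN0] := eqVneq alpha 0%R.
  have [hp|hn] := ltP 0%R h.
    apply: le_lt_trans (estar_moment a0 hp).
    apply: ge0_le_integral => //.
    - by move=> x _; rewrite lee_fin.
    - exact/measurable_EFinP.
    - exact: (measurableT_comp (measurable_epow h)).
    move=> x _; rewrite /epow ltNge h0/= /s/=.
    by case: (estar x) => [r| |] /=; rewrite ?(gt_eqF hp) ?powR0 ?(gt_eqF hp)// ?leey.
  apply: (@integral_bounded_lty _ 1%R) => // x.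
  have -> : h = 0%R by apply/eqP; rewrite eq_le hn h0.
  by rewrite powRr0 ler01 lexx.
apply: (@integral_bounded_lty _ (alpha^-1 `^ h)%R) => // [|x]; first exact: powR_ge0.
rewrite powR_ge0/= ge0_ler_powR ?nnegrE ?invr_ge0//.
- exact: s0.
- by have /andP[] := alpha01.
by have := s_cap x; rewrite inver (negbTE aN0) lee_fin.
Qed.

(* Optimality against [z = (1 - t) s + t u], with the tangent inequality at [z]
   and not at [s]: its slope [z^(h - 1)] is at most [((1 - t) s)^(h - 1)], which
   keeps the [s]-part integrable.  Replacing [z] by [s + t u >= z] makes the
   integrand monotone in [t]. *)
Let path_bound (t : R) u : (0 < t < 1)%R -> valid_evalue H (EFin \o u) ->
  (forall x, (u x)%:E <= cap) ->
  \int[Qa]_x ((s x + t * u x) `^ (h - 1) * u x)%:E <=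
    ((1 - t) `^ (h - 1))%:E * \int[Qa]_x (Z x)%:E.
Proof.
move=> /andP[t0 t1] vu uc.
have t1' : (0 < 1 - t)%R by rewrite subr_gt0.
have u0 := valid_evalue_ge0 vu; have um := valid_evalue_measurable vu.
pose z x := ((1 - t) * s x + t * u x)%R.
have z0 x : (0 <= z x)%R by rewrite addr_ge0// mulr_ge0// ltW.
have mz : measurable_fun setT z.
  by apply: measurable_funD; exact: measurable_funM.
have vz : valid_evalue H (EFin \o z).
  by apply: valid_evalue_conv => //; rewrite (ltW t0) ltW.
have zc x : (z x)%:E <= cap.
  move: (uc x) (s_cap x); rewrite inver; case: ifPn => [_ _ _|_].
    by rewrite leey.
  by rewrite /z !lee_fin /=; nra.
have [D [mD D0 DE]] := optimal_ge0 vz zc.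
pose p x := (z x `^ (h - 1))%R.
have p0 x : (0 <= p x)%R by exact: powR_ge0.
have mp : measurable_fun setT p by exact: mpow.
have psZ x : (p x * s x <= (1 - t) `^ (h - 1) * Z x)%R.
  move: (s0 x); rewrite le_eqVlt => /orP[/eqP sx|sx].
    by rewrite -sx mulr0 mulr_ge0// powR_ge0.
  rewrite -WsZ// mulrA -powRM//; last exact: ltW.
  rewrite ler_wpM2r//; apply: powR_antitone; rewrite ?mulr_gt0//.
    by rewrite subr_le0 ltW.
  by rewrite /z lerDl mulr_ge0// ltW.
have cE : \int[Qa]_x ((1 - t) `^ (h - 1) * Z x)%:E =
    ((1 - t) `^ (h - 1))%:E * \int[Qa]_x (Z x)%:E.
  under eq_integral do rewrite EFinM.
  rewrite ge0_integralZl//; first exact/measurable_EFinP.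
  - by move=> x _; rewrite lee_fin powR_ge0.
  - by rewrite lee_fin powR_ge0.
have mps : measurable_fun setT (fun x => p x * s x)%R by exact: measurable_funM.
have mpu : measurable_fun setT (fun x => p x * u x)%R by exact: measurable_funM.
have ps0 x : (0 <= p x * s x)%R by rewrite mulr_ge0.
have pu0 x : (0 <= p x * u x)%R by rewrite mulr_ge0.
have ps_le : \int[Qa]_x (p x * s x)%:E <=
    ((1 - t) `^ (h - 1))%:E * \int[Qa]_x (Z x)%:E.
  rewrite -cE; apply: ge0_le_integral => //.
  - by move=> x _; rewrite lee_fin.
  - exact/measurable_EFinP.
  - by apply/measurable_EFinP; exact: measurable_funM.
  - by move=> x _; rewrite lee_fin; exact: psZ.
have scaleE (f : X -> R) : measurable_fun setT f -> (forall x, 0 <= f x)%R ->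
    \int[Qa]_x (t * f x)%:E = t%:E * \int[Qa]_x (f x)%:E.
  move=> mf f0; under eq_integral do rewrite EFinM.
  rewrite ge0_integralZl//; first exact/measurable_EFinP.
  - by move=> x _; rewrite lee_fin.
  - by rewrite lee_fin ltW.
have ps_lty : \int[Qa]_x (p x * s x)%:E < +oo.
  by rewrite (le_lt_trans ps_le)// lte_mul_pinfty ?lee_fin ?powR_ge0.
have pups : \int[Qa]_x (t * (p x * u x))%:E <= \int[Qa]_x (t * (p x * s x))%:E.
  apply: (integral_le_of_integralB_ge0 mD) => //.
  - exact: measurable_funM.
  - exact: measurable_funM.
  - by move=> x; rewrite mulr_ge0// ltW.
  - by move=> x; rewrite mulr_ge0// ltW.
  - apply: filterS DE => x ->.
    move: (z0 x); rewrite le_eqVlt => /orP[/eqP zx|zx].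
      have sx : s x = 0%R.
        by apply/eqP; rewrite eq_le s0 andbT; move: zx; rewrite /z; have := u0 x; nra.
      rewrite -zx sx /p -zx powR0; last by rewrite subr_eq0 lt_eqF.
      rewrite !mul0r mulr0 subrr.
      have [hp|hn] := ltP 0%R h; first by rewrite power_utility0_pos// subee.
      by rewrite power_utility0_npos// addNye leNye.
    rewrite -leeN2 oppeB; last first.
      by rewrite fin_num_adde_defl// fin_numN power_utility_fin_num.
    rewrite addeC; apply: le_trans (power_utility_tangent h1 zx (s0 x)).
    by rewrite -EFinN lee_fin le_eqVlt /p /z; apply/orP; left; apply/eqP; ring.
  - by rewrite scaleE// lte_mul_pinfty// lee_fin ltW.
move: pups; rewrite !scaleE// lee_pmul2l// ?lte_fin// => pups.
apply: le_trans ps_le; apply: le_trans pups.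
apply: ge0_le_integral => //.
- by move=> x _; rewrite lee_fin mulr_ge0// powR_ge0.
- apply/measurable_EFinP/measurable_funM => //; apply: mpow.
  by apply: measurable_funD => //; exact: measurable_funM.
- exact/measurable_EFinP.
- move=> x _; rewrite lee_fin ler_wpM2r//.
  move: (z0 x); rewrite le_eqVlt => /orP[/eqP zx|zx].
    have [-> ->] : s x = 0%R /\ u x = 0%R.
      by split; apply/eqP; rewrite eq_le ?s0 ?u0 andbT;
        move: zx; rewrite /z; have := u0 x; have := s0 x; nra.
    by rewrite mulr0 addr0 powR0 ?powR_ge0// subr_eq0 lt_eqF.
  apply: powR_antitone => //; first by rewrite subr_le0 ltW.
  by rewrite /z lerD2r; have := s0 x; nra.
Qed.

(* For [u = 1] the bound reads [t^(h - 1) Qa(s = 0) <= 2^(1 - h) E[s^h]] for all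
   [t <= 1/2], and [t^(h - 1)] is unbounded. *)
Let optimal_positive : {ae Qa, forall x, (0 < s x)%R}.
Proof.
pose N := [set x | s x = 0%R].
have mN : measurable N.
  by rewrite -[N]setTI; exact: (ms measurableT (measurable_set1 0%R)).
exists N; split=> //; last first.
  by move=> x /= /negP; rewrite lt0r s0 andbT negbK => /eqP.
have bound (t : R) : (0 < t < 1)%R -> (t `^ (h - 1))%:E * Qa N <=
    ((1 - t) `^ (h - 1))%:E * \int[Qa]_x (Z x)%:E.
  move=> t01; apply: le_trans (path_bound t01 one_valid (fun=> cap_ge1)).
  rewrite -integral_cst// [leLHS]integral_mkcond.
  apply: ge0_le_integral => //.
  - by move=> x _; apply: erestrict_ge0 => y _; rewrite lee_fin powR_ge0.
  - by apply/(measurable_restrictT _ mN); exact: measurable_cst.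
  - apply/measurable_EFinP/measurable_funM => //; apply: mpow.
    by apply: measurable_funD => //; exact: measurable_funM.
  move=> x _; rewrite patchE; case: ifPn => xN; last by rewrite lee_fin mulr_ge0 ?powR_ge0.
  by move: xN; rewrite inE /N/= => ->; rewrite add0r !mulr1.
apply/eqP; rewrite eq_le measure_ge0 andbT leNgt; apply/negP => qN0.
have Nfin : Qa N \is a fin_num.
  rewrite ge0_fin_numE//; apply: le_lt_trans (lebesgue_decomposition_fin HQ).
  by apply: le_measure; rewrite ?inE.
have Zfin : \int[Qa]_x (Z x)%:E \is a fin_num.
  by rewrite ge0_fin_numE ?integral_ge0// => x _; rewrite lee_fin powR_ge0.
move: qN0 bound; rewrite -(fineK Nfin) -(fineK Zfin).
set q := fine (Qa N); set c := fine (\int[Qa]_x (Z x)%:E) => q0 bound.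
rewrite lte_fin in q0.
have c0 : (0 <= c)%R.
  by apply: fine_ge0; apply: integral_ge0 => x _; rewrite lee_fin powR_ge0.
have hN : (0 < 1 - h)%R by rewrite subr_gt0.
pose M := (2^-1 `^ (h - 1) * c)%R.
have M0 : (0 <= M)%R by rewrite mulr_ge0// powR_ge0.
(* The second argument is chosen so that [t^(1 - h) M < q]. *)
pose t := (Num.min 2^-1 ((q / (M + 1)) `^ (1 - h)^-1))%R.
have r0 : (0 < q / (M + 1))%R by rewrite divr_gt0// ltr_pwDr.
have t0 : (0 < t)%R by rewrite lt_min invr_gt0 ltr0n powR_gt0.
have t2 : (t <= 2^-1)%R by rewrite ge_min lexx.
have t01 : (0 < t < 1)%R by rewrite t0 (le_lt_trans t2)// invf_lt1 ?ltr0n ?ltr1n.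
have tq : (t `^ (1 - h) <= q / (M + 1))%R.
  have : (t <= (q / (M + 1)) `^ (1 - h)^-1)%R by rewrite ge_min lexx orbT.
  move/(ge0_ler_powR (ltW hN)); rewrite !nnegrE (ltW t0) powR_ge0 => /(_ isT isT).
  by rewrite -powRrM mulVf ?gt_eqF// powRr1// ltW.
have := bound _ t01; rewrite -!EFinM lee_fin => qb.
have qM : (t `^ (h - 1) * q <= M)%R.
  apply: le_trans qb _; rewrite ler_wpM2r//; apply: powR_antitone.
  - by rewrite subr_le0 ltW.
  - by rewrite invr_gt0 ltr0n.
  - by lra.
have tE : (t `^ (h - 1) = (t `^ (1 - h))^-1)%R by rewrite -powRN opprB.
have {}qM : (q <= M * t `^ (1 - h))%R.
  by move: qM; rewrite tE mulrC ler_pdivrMr ?powR_gt0.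
have : (q <= M * (q / (M + 1)))%R by apply: le_trans qM _; rewrite ler_wpM2l.
rewrite mulrCA mulrA -[leLHS]mulr1 -mulrA ler_pM2l//.
by rewrite ler_pdivlMr ?ltr_pwDr// mul1r gerDl leNgt ltr01.
Qed.

Let lim_bound u : valid_evalue H (EFin \o u) -> (forall x, (u x)%:E <= cap) ->
  \int[Qa]_x (W x * u x)%:E <= \int[Qa]_x (Z x)%:E.
Proof.
move=> vu uc.
have u0 := valid_evalue_ge0 vu; have um := valid_evalue_measurable vu.
pose t n : R := (n.+2%:R^-1)%R.
have t01 n : (0 < t n < 1)%R by rewrite invr_gt0 ltr0n invf_lt1 ?ltr0n ?ltr1n.
have t0 n : (0 <= t n)%R by have /andP[/ltW] := t01 n.
have tnd m n : (m <= n)%N -> (t n <= t m)%R.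
  by move=> mn; rewrite lef_pV2 ?posrE ?ltr0n// ler_nat.
have tcvg : t n @[n --> \oo] --> 0%R.
  by have := @cvg_harmonic R; rewrite -cvg_shiftS.
have powR_cvg (x : R) : (0 < x)%R -> {for x, continuous (@powR R ^~ (h - 1)%R)}.
  move=> x0; apply/differentiable_continuous/derivable1_diffP.
  by apply: derivable_powR; rewrite in_itv/= andbT.
pose P := [set x | (0 < s x)%R].
have mP : measurable P.
  rewrite (_ : P = s @^-1` `]0%R, +oo[).
    by rewrite -[X in measurable X]setTI; exact: ms.
  by apply/seteqP; split => x; rewrite /P /= in_itv/= andbT.
(* The indicator makes [g n] converge to [W u] at every point, since
   [0 `^ (h - 1) = 0] in the real power. *)
pose g n x := ((s x + t n * u x) `^ (h - 1) * u x * \1_P x)%R.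
have g0 n x : (0 <= g n x)%R by rewrite !mulr_ge0// powR_ge0.
have mg n : measurable_fun setT (g n).
  apply: measurable_funM => //; apply: measurable_funM => //; apply: mpow.
  by apply: measurable_funD => //; exact: measurable_funM.
have gcvg x : (g n x)%:E @[n --> \oo] --> (W x * u x)%:E.
  apply: cvg_EFin; first exact: nearW.
  rewrite /g indicE; have [xP|xP] := boolP (x \in P); last first.
    move: xP; rewrite notin_setE /P/= => /negP; rewrite -leNgt => sx.
    have /= -> : s x = 0%R by apply/eqP; rewrite eq_le sx s0.
    rewrite powR0 ?mul0r ?subr_eq0 ?lt_eqF//.
    by under eq_fun do rewrite mulr0; exact: cvg_cst.
  under eq_fun do rewrite mulr1.
  have zcvg : (s x + t n * u x)%R @[n --> \oo] --> s x.
    rewrite -[X in _ --> X]addr0 -[X in _ --> (_ + X)%R](mul0r (u x)).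
    by apply: cvgD; [exact: cvg_cst|exact: cvgMl].
  have sx : (0 < s x)%R by move: xP; rewrite inE.
  by apply: cvgMl; exact: (continuous_cvg _ (powR_cvg _ sx) zcvg).
have gnd x : nondecreasing_seq (fun n => (g n x)%:E).
  move=> m n mn; rewrite lee_fin /g.
  rewrite indicE; have [|_] := boolP (x \in P); last by rewrite !mulr0.
  rewrite inE /P/= => sx; rewrite !mulr1 ler_wpM2r//.
  apply: powR_antitone; first by rewrite subr_le0 ltW.
    by rewrite ltr_pwDl// mulr_ge0.
  by rewrite lerD2l ler_wpM2r// tnd.
have gle n : \int[Qa]_x (g n x)%:E <=
    ((1 - t n) `^ (h - 1))%:E * \int[Qa]_x (Z x)%:E.
  apply: le_trans (path_bound (t01 n) vu uc).
  apply: ge0_le_integral => //.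
  - by move=> x _; rewrite lee_fin.
  - exact/measurable_EFinP.
  - apply/measurable_EFinP/measurable_funM => //; apply: mpow.
    by apply: measurable_funD => //; exact: measurable_funM.
  - by move=> x _; rewrite lee_fin ler_piMr ?mulr_ge0 ?powR_ge0.
have Zfin : \int[Qa]_x (Z x)%:E \is a fin_num.
  by rewrite ge0_fin_numE ?integral_ge0// => x _; rewrite lee_fin powR_ge0.
have dcvg : ((1 - t n) `^ (h - 1))%:E * \int[Qa]_x (Z x)%:E @[n --> \oo] -->
    \int[Qa]_x (Z x)%:E.
  rewrite -[X in _ --> X]mul1e; apply: cvgeZr => //.
  apply: cvg_EFin; first exact: nearW.
  have p1 : (1 `^ (h - 1) = 1 :> R)%R by rewrite powR1.
  rewrite -[X in _ --> X]p1.
  have dcvg : (1 - t n)%R @[n --> \oo] --> (1%R : R).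
    rewrite -[X in _ --> X]subr0.
    by apply: cvgB; [exact: cvg_cst|exact: tcvg].
  exact: (continuous_cvg _ (powR_cvg _ ltr01) dcvg).
have intcvg : \int[Qa]_x (g n x)%:E @[n --> \oo] --> \int[Qa]_x (W x * u x)%:E.
  rewrite (_ : \int[Qa]_x (W x * u x)%:E = \int[Qa]_x (limn (fun n => (g n x)%:E))).
    apply: cvg_monotone_convergence => //.
    - by move=> n; exact/measurable_EFinP.
    - by move=> n x _; rewrite lee_fin.
  by apply: eq_integral => x _; apply/esym/cvg_lim.
rewrite -(cvg_lim _ intcvg)// -(cvg_lim _ dcvg)//.
by apply: lee_lim; [exact: cvgP intcvg|exact: cvgP dcvg|exact: nearW].
Qed.

Lemma optimal_first_order : first_order.
Proof. by split; [exact: optimal_positive|exact: moment_lty|exact: lim_bound]. Qed.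

End necessity.

Let integrable_ge0 (f : X -> R) : measurable_fun setT f ->
  (forall x, 0 <= f x)%R -> \int[Qa]_x (f x)%:E < +oo ->
  Qa.-integrable setT (EFin \o f).
Proof.
move=> mf f0 foo; apply/integrableP; split; first exact/measurable_EFinP.
by under eq_integral do rewrite gee0_abs ?lee_fin//.
Qed.

Let Z_ge0 x : (0 <= Z x)%R. Proof. exact: powR_ge0. Qed.
Let Wu_ge0 u : (forall x, 0 <= u x)%R -> forall x, (0 <= W x * u x)%R.
Proof. by move=> u0 x; rewrite mulr_ge0// powR_ge0. Qed.

Let fine_capped (z : \bar R) : 0 <= z -> z <= cap -> (fine z)%:E <= cap.
Proof. by case: z => [r| |] //= _ _; rewrite (le_trans _ cap_ge1). Qed.

(** * Optimality and the variational inequality *)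

Let epow_pole : epow 0 (h - 1) = +oo :> \bar R.
Proof.
by rewrite /epow subr_lt0 h1 poweR0r ?inve0// oppr_eq0 subr_eq0 lt_eqF.
Qed.

Let variation e x := epow (estar x) (h - 1) * (e x - estar x).

Let measurable_variation e : measurable_fun setT e ->
  measurable_fun setT (variation e).
Proof.
move=> me; apply: emeasurable_funM; last exact: emeasurable_funB.
exact: (measurableT_comp (measurable_epow (h - 1)%R)).
Qed.

Let variationE e : valid_evalue H e -> {ae Qa, forall x, (0 < s x)%R} ->
  {ae Qa, forall x, variation e x = (W x * fine (e x) - Z x)%:E}.
Proof.
move=> ve; apply: filterS3 estar_fine (valid_evalue_ae_fine HQ ve).
move=> x sE eE sx; rewrite /variation eE sE epow_EFin// -EFinB -EFinM.
by rewrite mulrBr WsZ.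
Qed.

(** Truncating a competitor at the cap changes neither its validity nor its
    capped utility; the tangent inequality at [s] then bounds the utility
    difference from below by the integrable function [Z - W u]. *)
Lemma first_order_optimal : first_order -> utility_optimal H Qa U estar.
Proof.
move=> [sp Zoo FO]; split=> // e ve D.
pose e' x := mine (e x) cap.
have [me e0 _] := ve.
have me' : measurable_fun setT e' by exact: measurable_mine.
have e'0 x : 0 <= e' x by rewrite le_min e0 (le_trans _ cap_ge1).
have ve' : valid_evalue H e'.
  by apply: valid_evalue_le ve => // x; rewrite ge_min lexx.
pose u := fine \o e'.
have vu : valid_evalue H (EFin \o u) by exact: valid_evalue_fine.
have um := valid_evalue_measurable vu; have u0 := valid_evalue_ge0 vu.
have uc x : (u x)%:E <= cap by apply: fine_capped; rewrite ?ge_min ?lexx ?orbT.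
have DE : {ae Qa, forall x, D x = power_utility h (s x)%:E - power_utility h (u x)%:E}.
  apply: filterS2 estar_fine (valid_evalue_ae_fine HQ ve') => x sE e'E.
  rewrite /D {1}sE utility_capped//; congr (_ - _).
  by rewrite /capped_power_utility -/(e' x) e'E.
have mWu : measurable_fun setT (fun x => W x * u x)%R by exact: measurable_funM.
have iZ : Qa.-integrable setT (EFin \o Z) by exact: integrable_ge0.
have iWu : Qa.-integrable setT (EFin \o (fun x => W x * u x)%R).
  by apply: integrable_ge0 => //; [exact: Wu_ge0|exact: le_lt_trans (FO u vu uc) Zoo].
have mD : measurable_fun setT D.
  have mU := measurable_capped_power_utility alpha h.
  by apply: emeasurable_funB; exact: (measurableT_comp mU).
have [|||Dn D0] := @integral_ge0_of_ge _ _ _ Qa D (fun x => Z x - W x * u x)%R mD.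
- rewrite (_ : _ \o _ = (EFin \o Z) \- (EFin \o (fun x => W x * u x)%R))//.
  exact: integrableB.
- apply: filterS2 DE sp => x -> sx.
  rewrite -WsZ// -mulrBr; exact: power_utility_tangent.
- under eq_integral do rewrite EFinB.
  rewrite integralB_EFin// sube_ge0; first exact: FO.
  by rewrite integrable_fin_num.
split=> //; last by right.
apply: filterS2 estar_fine sp => x sE sx.
rewrite {1}sE utility_capped// fin_num_adde_defr//.
exact: power_utility_fin_num.
Qed.

Lemma first_order_variation e : first_order ->
  valid_evalue H e -> (forall x, e x <= cap) ->
  Qa.-integrable setT (variation e) /\ \int[Qa]_x variation e x <= 0.
Proof.
move=> [sp Zoo FO] ve ec.
have [me e0 _] := ve.
pose u := fine \o e.
have vu : valid_evalue H (EFin \o u) by exact: valid_evalue_fine.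
have um := valid_evalue_measurable vu; have u0 := valid_evalue_ge0 vu.
have uc x : (u x)%:E <= cap by exact: fine_capped.
have gE := variationE ve sp.
have mg := measurable_variation me.
have mWu : measurable_fun setT (fun x => W x * u x)%R by exact: measurable_funM.
have iZ : Qa.-integrable setT (EFin \o Z) by exact: integrable_ge0.
have iWu : Qa.-integrable setT (EFin \o (fun x => W x * u x)%R).
  by apply: integrable_ge0 => //; [exact: Wu_ge0|exact: le_lt_trans (FO u vu uc) Zoo].
have ir : Qa.-integrable setT (fun x => (W x * u x - Z x)%:E).
  rewrite (_ : (fun x => _) = (EFin \o (fun x => W x * u x)%R) \- (EFin \o Z))//.
  exact: integrableB.
have mr := measurable_int _ ir.
split.
  apply/integrableP; split=> //.
  have /integrableP[_] := ir; rewrite (ae_eq_integral (fun x => `|variation e x|))//.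
  - exact: measurableT_comp.
  - exact: measurableT_comp.
  - by apply: filterS gE => x -> _.
rewrite (ae_eq_integral (fun x => (W x * u x - Z x)%:E))//; last first.
  by apply: filterS gE => x -> _.
under eq_integral do rewrite EFinB.
rewrite integralB_EFin// sube_le0; exact: FO.
Qed.

(** Integrability for [e = 1] forces [s > 0], because the variation is infinite
    where [s = 0]; integrability for [e = 0] is the finiteness of [E[s^h]]. *)
Lemma variation_first_order :
  (forall e, valid_evalue H e -> (forall x, e x <= cap) ->
    Qa.-integrable setT (variation e) /\ \int[Qa]_x variation e x <= 0) ->
  first_order.
Proof.
move=> V.
have v1 : valid_evalue H (fun=> 1%:E) by apply: valid_evalue_cst; rewrite ler01 lexx.
have v0 : valid_evalue H (fun=> 0%:E) by apply: valid_evalue_cst; rewrite lexx ler01.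
have cap0 : 0 <= cap by exact: le_trans cap_ge1.
have sp : {ae Qa, forall x, (0 < s x)%R}.
  have [i1 _] := V _ v1 (fun=> cap_ge1).
  apply: filterS2 estar_fine (integrable_ae measurableT i1) => x sE /(_ I).
  rewrite lt0r s0 andbT; apply: contraL => /eqP sx.
  by rewrite /variation sE sx epow_pole sube0 mule1.
have Zoo : \int[Qa]_x (Z x)%:E < +oo.
  have [/integrableP[mg +] _] := V _ v0 (fun=> cap0).
  rewrite (ae_eq_integral (fun x => (Z x)%:E))//.
  - exact: measurableT_comp.
  - exact/measurable_EFinP.
  - apply: filterS (variationE v0 sp) => x -> _ /=.
    by rewrite mulr0 sub0r normrN ger0_norm ?Z_ge0.
split=> // u vu uc.
have um := valid_evalue_measurable vu; have u0 := valid_evalue_ge0 vu.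
have [iv vle0] := V _ vu uc.
apply: (@integral_le_of_integralB_ge0 _ _ _ Qa (\- variation (EFin \o u))) => //.
- by apply: measurableT_comp => //; exact/measurable_variation/measurable_EFinP.
- exact: measurable_funM.
- exact: Wu_ge0.
- apply: filterS (variationE vu sp) => x -> /=.
  by rewrite opprB.
- rewrite integralN ?oppe_ge0//.
  exact: integrable_add_def.
Qed.

(** * Multipliers imply the first-order condition *)

(* Here [y = lambda f x]. *)
Let capped_power_cases (x : X) (y : R) : (0 <= y)%R ->
  (s x)%:E = mine (epow y%:E (- (1 - h)^-1)) cap ->
  (0 < s x)%R /\ (W x = y \/ (y <= W x)%R /\ (s x)%:E = cap).
Proof.
have c0 : (0 < (1 - h)^-1)%R by rewrite invr_gt0 subr_gt0.
have cap_case : (s x)%:E = cap -> (0 < s x)%R.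
  move=> sE; rewrite -lte_fin sE; exact: lt_le_trans cap_ge1.
have WyK (z : R) : (0 < z)%R -> ((z `^ (- (1 - h)^-1)) `^ (h - 1) = z)%R.
  move=> z0; rewrite -powRrM -[X in (_ * X)%R]opprB mulrNN mulVf ?powRr1 ?(ltW z0)//.
  by rewrite subr_eq0 gt_eqF.
rewrite le_eqVlt => /orP[/eqP <-|y0].
  rewrite /epow oppr_lt0 c0 opprK poweR0r ?gt_eqF// inve0 min_r ?leey// => sE.
  by split; [exact: cap_case|right; rewrite powR_ge0].
rewrite epow_EFin//; have [yc|cy] := leP (y `^ (- (1 - h)^-1))%:E cap => sE.
  have {}sE : s x = (y `^ (- (1 - h)^-1))%R by case: sE.
  by split; [rewrite sE powR_gt0|left; rewrite sE WyK].
split; first exact: cap_case.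
right; split=> //; rewrite -[leLHS]WyK//; apply: powR_antitone.
- by rewrite subr_le0 ltW.
- exact: cap_case.
- by rewrite -lee_fin sE ltW.
Qed.

(** The case analysis gives [W u + lambda f s <= lambda f u + Z] for every capped
    [u], and slackness makes [\int lambda f s = lambda >= \int lambda f u]. *)
Lemma multiplier_first_order (lambda : R) (P : {measure set X -> \bar R})
    (f : X -> R) :
  (0 <= lambda)%R -> effective_hypothesis H P ->
  is_radon_nikodym_derivative P Qa f ->
  {ae Qa, forall x, estar x =
    mine (epow (lambda * f x)%:E (- (1 - h)^-1)) cap} ->
  lambda%:E * (1 - \int[P]_x estar x) = 0 -> first_order.
Proof.
move=> l0 effP PQa estarE slack.
have [mf f0 _] := PQa.
have lf0 x : (0 <= lambda * f x)%R by rewrite mulr_ge0.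
have cases : {ae Qa, forall x, (0 < s x)%R /\ (W x = (lambda * f x)%R \/
    (lambda * f x <= W x)%R /\ (s x)%:E = cap)}.
  apply: filterS2 estar_fine estarE => x sE; rewrite {1}sE.
  exact: capped_power_cases.
have sp : {ae Qa, forall x, (0 < s x)%R} by apply: filterS cases => x [].
have intP u : valid_evalue H (EFin \o u) ->
    \int[Qa]_x (lambda * (f x * u x))%:E = lambda%:E * \int[P]_x (u x)%:E.
  move=> vu; have um := valid_evalue_measurable vu; have u0 := valid_evalue_ge0 vu.
  rewrite (integral_density PQa); last 2 first.
  - exact/measurable_EFinP.
  - by move=> x; rewrite lee_fin.
  rewrite -ge0_integralZl//.
  - by apply: emeasurable_funM; exact/measurable_EFinP.
  - by move=> x _; rewrite mule_ge0// lee_fin.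
have intP_le u : valid_evalue H (EFin \o u) ->
    \int[Qa]_x (lambda * (f x * u x))%:E <= lambda%:E.
  move=> vu; rewrite intP// -[leRHS]mule1 lee_wpmul2l ?lee_fin//.
  exact: effP vu.
have intPs : \int[Qa]_x (lambda * (f x * s x))%:E = lambda%:E.
  rewrite intP//; move: slack.
  have -> : \int[P]_x estar x = \int[P]_x (s x)%:E.
    rewrite !(integral_density PQa)//; last exact/measurable_EFinP.
    apply: ae_eq_integral => //.
    - by apply: emeasurable_funM => //; exact/measurable_EFinP.
    - by apply: emeasurable_funM => //; exact/measurable_EFinP.
    - by apply: filterS estar_fine => x {1}-> _.
  have := effP _ s_valid.
  have : 0 <= \int[P]_x (s x)%:E by apply: integral_ge0 => x _; rewrite lee_fin.
  rewrite /=; case: (\int[P]_x _) => [a| |]// a0 a1.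
  rewrite -EFinB -!EFinM => /eqP; rewrite eqe mulrBr mulr1 subr_eq0 => /eqP al.
  by rewrite -al.
have ml : measurable_fun setT (fun x => lambda * (f x * s x))%R.
  by apply: measurable_funM => //; exact: measurable_funM.
have ls0 x : (0 <= lambda * (f x * s x))%R by rewrite !mulr_ge0.
have Zoo : \int[Qa]_x (Z x)%:E < +oo.
  pose K := (alpha^-1 `^ h)%R; have K0 : (0 <= K)%R by exact: powR_ge0.
  apply: (@le_lt_trans _ _ (\int[Qa]_x ((lambda * (f x * s x))%:E + K%:E))).
    apply: ae_ge0_le_integral => //.
    - by move=> x _; rewrite lee_fin.
    - exact/measurable_EFinP.
    - by move=> x _; rewrite adde_ge0// lee_fin.
    - by apply: emeasurable_funD => //; exact/measurable_EFinP.
    apply: filterS cases => x [sx Wx] _; rewrite -EFinD lee_fin.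
    case: Wx => [Wx|[_ sc]]; first by rewrite -WsZ// Wx mulrA lerDl.
    rewrite (_ : Z x = K) ?lerDr//.
    by move: sc; rewrite inver; case: ifPn => //= _ [->].
  rewrite ge0_integralD//; last 2 first.
  - by move=> x _; rewrite lee_fin.
  - exact/measurable_EFinP.
  rewrite intPs lte_add_pinfty ?ltry//.
  by apply: (@integral_bounded_lty (cst K) K) => // x; rewrite /= K0 lexx.
split=> // u vu uc.
have um := valid_evalue_measurable vu; have u0 := valid_evalue_ge0 vu.
have mlu : measurable_fun setT (fun x => lambda * (f x * u x))%R.
  by apply: measurable_funM => //; exact: measurable_funM.
have mWu : measurable_fun setT (fun x => W x * u x)%R by exact: measurable_funM.
have lu0 x : (0 <= lambda * (f x * u x))%R by rewrite !mulr_ge0.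
have Wu0 := Wu_ge0 u0.
have : \int[Qa]_x ((W x * u x)%:E + (lambda * (f x * s x))%:E) <=
    \int[Qa]_x ((lambda * (f x * u x))%:E + (Z x)%:E).
  apply: ae_ge0_le_integral => //.
  - by move=> x _; rewrite adde_ge0// lee_fin.
  - by apply: emeasurable_funD; exact/measurable_EFinP.
  - by move=> x _; rewrite adde_ge0// lee_fin.
  - by apply: emeasurable_funD; exact/measurable_EFinP.
  apply: filterS cases => x [sx Wx] _; rewrite -!EFinD lee_fin -(WsZ sx).
  case: Wx => [->|[lW sc]]; first by rewrite -!mulrA.
  have us : (0 <= s x - u x)%R by rewrite subr_ge0 -lee_fin sc.
  have := ler_wpM2r us lW; lra.
rewrite !ge0_integralD//; try exact/measurable_EFinP;
  try by move=> x _; rewrite lee_fin.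
rewrite intPs addeC => Wul.
rewrite -(@leeD2lE _ lambda%:E)//; apply: le_trans Wul _.
by rewrite leeD2r// intP_le.
Qed.

(** * Existence of multipliers *)

Section multiplier.
Hypothesis FO : first_order.

Local Notation kappa := (alpha^-1)%R.
Let A : set X := [set x | (s x)%:E = cap].

Let mA : measurable A.
Proof.
rewrite -[A]setTI; apply: measurable_eqe => //; exact/measurable_EFinP.
Qed.

Let sA x : A x -> s x = kappa.
Proof. by rewrite /A/= inver; case: ifPn => //= _ [->]. Qed.

Let sp : {ae Qa, forall x, (0 < s x)%R}. Proof. by case: FO. Qed.
Let Zoo : \int[Qa]_x (Z x)%:E < +oo. Proof. by case: FO. Qed.

Let WsZ_integral : \int[Qa]_x (W x * s x)%:E = \int[Qa]_x (Z x)%:E.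
Proof.
apply: ae_eq_integral => //.
- by apply/measurable_EFinP; exact: measurable_funM.
- exact/measurable_EFinP.
- by apply: filterS sp => x /WsZ -> _.
Qed.

Let WsR : {c : R | \int[Qa]_x (W x * s x)%:E = c%:E}.
Proof.
exists (fine (\int[Qa]_x (W x * s x)%:E)); rewrite fineK// WsZ_integral.
by rewrite ge0_fin_numE// integral_ge0// => x _; rewrite lee_fin Z_ge0.
Qed.

Let iW : Qa.-integrable setT (EFin \o W).
Proof.
apply: integrable_ge0 => //; first by move=> x; exact: powR_ge0.
have v1 : valid_evalue H (EFin \o (cst 1%R : X -> R)).
  by apply: valid_evalue_cst; rewrite ler01 lexx.
have [_ _ /(_ _ v1 (fun=> cap_ge1))] := FO.
by under eq_integral do rewrite mulr1; move=> /le_lt_trans; apply.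
Qed.

(* The points off [A] where the perturbation [s + sigma e] has not yet hit the
   cap; they exhaust the complement of [A] as [sigma] tends to 0. *)
Let reach (sigma : R) (e : X -> R) : set X :=
  ~` A `&` [set x | (s x + sigma * e x)%:E <= cap].

(* The competitor is [(1 - sigma t) s + sigma y], where [y] is the part of [e]
   that can be added without exceeding the cap: all of [e] on [reach], and
   [min(e, t kappa)] on [A], where [s = kappa]. *)
Let directional_step (t sigma : R) (e : X -> R) :
  (0 <= t)%R -> (0 < sigma)%R -> (sigma * t <= 1)%R ->
  measurable_fun setT e -> (forall x, 0 <= e x)%R ->
  (forall P, H P -> \int[P]_x (e x)%:E <= t%:E) ->
  \int[Qa]_x (W x * (e x * \1_(reach sigma e) x
                     + Num.min (e x) (t * kappa) * \1_A x))%:E <=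
    t%:E * \int[Qa]_x (W x * s x)%:E.
Proof.
move=> t0 sg0 sgt me e0 He.
pose B := reach sigma e; rewrite -/B.
have a0 : (0 <= alpha)%R by have /andP[] := alpha01.
have tk0 : (0 <= t * kappa)%R by rewrite mulr_ge0// invr_ge0.
have st0 : (0 <= 1 - sigma * t)%R by rewrite subr_ge0.
have mB : measurable B.
  apply: measurableI; first exact: measurableC.
  rewrite -[X in measurable X]setTI; apply: measurable_lee => //.
  apply/measurable_EFinP/measurable_funD => //; exact: measurable_funM.
pose y x := (e x * \1_B x + Num.min (e x) (t * kappa) * \1_A x)%R.
have my : measurable_fun setT y.
  apply: measurable_funD; apply: measurable_funM => //.
  by apply: measurable_minr.
have y0 x : (0 <= y x)%R.
  by rewrite addr_ge0// mulr_ge0// le_min e0.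
have yA x : A x -> y x = (Num.min (e x) (t * kappa))%R.
  move=> Ax; rewrite /y !indicE (mem_set Ax) mulr1.
  by rewrite memNset ?mulr0 ?add0r// => -[].
have yB x : B x -> y x = e x.
  move=> Bx; rewrite /y !indicE (mem_set Bx) mulr1.
  by rewrite memNset ?mulr0 ?addr0// => Ax; case: Bx.
have yN x : ~ A x -> ~ B x -> y x = 0%R.
  by move=> Ax Bx; rewrite /y !indicE !memNset// !mulr0 addr0.
have ye x : (y x <= e x)%R.
  have [Ax|Ax] := pselect (A x); first by rewrite yA// ge_min lexx.
  by have [Bx|Bx] := pselect (B x); [rewrite yB|rewrite yN].
pose v x := ((1 - sigma * t) * s x + sigma * y x)%R.
have vv : valid_evalue H (EFin \o v).
  split => [|x|P HP].
  - by apply/measurable_EFinP; apply: measurable_funD; exact: measurable_funM.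
  - by rewrite lee_fin addr_ge0// mulr_ge0// ltW.
  rewrite /= integral_lincomb//; last exact: ltW.
  have [_ _ /(_ P HP) Ps] := s_valid.
  have Py : \int[P]_x (y x)%:E <= t%:E.
    apply: le_trans (He P HP); apply: ge0_le_integral => //.
    - by move=> x _; rewrite lee_fin.
    - exact/measurable_EFinP.
    - exact/measurable_EFinP.
    - by move=> x _; rewrite lee_fin.
  apply: (@le_trans _ _ ((1 - sigma * t)%:E * 1 + sigma%:E * t%:E)).
    by apply: leeD; apply: lee_wpmul2l => //; rewrite lee_fin ltW.
  by rewrite mule1 -EFinM -EFinD subrK.
have vc x : (v x)%:E <= cap.
  have [Ax|Ax] := pselect (A x).
    rewrite -[leRHS]Ax lee_fin /v yA// (sA Ax).
    have : (Num.min (e x) (t * kappa) <= t * kappa)%R by rewrite ge_min lexx orbT.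
    by move/(ler_wpM2l (ltW sg0)); rewrite /=; lra.
  have [Bx|Bx] := pselect (B x); last first.
    rewrite /v yN// mulr0 addr0; apply: le_trans (s_cap x).
    by rewrite lee_fin ler_piMl// gerBl mulr_ge0// ltW.
  rewrite /v yB//; case: Bx => _ /=; apply: le_trans.
  rewrite lee_fin lerD2r; apply: ler_piMl; first exact: s0.
  by rewrite gerBl mulr_ge0// ltW.
have [_ _ /(_ v vv vc)] := FO; rewrite -WsZ_integral.
rewrite (_ : (fun x => _) = fun x => ((1 - sigma * t) * (W x * s x)
  + sigma * (W x * y x))%:E); last by apply/funext => x; congr EFin; rewrite /v; ring.
have mWy : measurable_fun setT (fun x => W x * y x)%R by exact: measurable_funM.
rewrite integral_lincomb//; first last.
- exact: Wu_ge0.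
- exact: Wu_ge0.
- exact: measurable_funM.
- exact: ltW.
have [c ->] := WsR.
have : 0 <= \int[Qa]_x (W x * y x)%:E.
  by apply: integral_ge0 => x _; rewrite lee_fin; exact: Wu_ge0.
case: (\int[Qa]_x _) => [r| |]//; last by rewrite gt0_muley ?lte_fin.
rewrite -!EFinM -EFinD !lee_fin => r0 cr.
have : (sigma * r <= sigma * (t * c))%R by lra.
by rewrite ler_pM2l.
Qed.

(* Off [A] this has the full [e], on [A] its truncation at [t kappa]; since
   [t kappa - min(e, t kappa) = (t kappa - e)^+] and [s = kappa] on [A], it is
   the inequality required by the sandwich theorem. *)
Let directional (t : R) (e : X -> R) :
  (0 <= t)%R -> measurable_fun setT e -> (forall x, 0 <= e x)%R ->
  (forall P, H P -> \int[P]_x (e x)%:E <= t%:E) ->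
  \int[Qa]_x (W x * (e x * \1_(~` A) x + Num.min (e x) (t * kappa) * \1_A x))%:E
    <= t%:E * \int[Qa]_x (W x * s x)%:E.
Proof.
move=> t0 me e0 He.
(* The factor [t + 1] ensures [sg n * t <= 1]. *)
pose sg n : R := ((t + 1) * n.+1%:R)^-1%R.
have sg0 n : (0 < sg n)%R by rewrite invr_gt0 mulr_gt0// ltr_wpDl.
have sgt n : (sg n * t <= 1)%R.
  rewrite mulrC ler_pdivrMr ?mulr_gt0 ?ltr_wpDl// mul1r.
  rewrite -[leLHS]mulr1 ler_pM// ?lerDl ?addr_ge0//.
  by rewrite ler1n.
have sgnd m n : (m <= n)%N -> (sg n <= sg m)%R.
  move=> mn; rewrite lef_pV2 ?posrE ?mulr_gt0 ?ltr_wpDl// ler_wpM2l ?addr_ge0//.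
  by rewrite ler_nat.
pose B n := reach (sg n) e.
have a0 : (0 <= alpha)%R by have /andP[] := alpha01.
have tk0 : (0 <= t * kappa)%R by rewrite mulr_ge0// invr_ge0.
pose y n x := (e x * \1_(B n) x + Num.min (e x) (t * kappa) * \1_A x)%R.
have mB n : measurable (B n).
  apply: measurableI; first exact: measurableC.
  rewrite -[X in measurable X]setTI; apply: measurable_lee => //.
  apply/measurable_EFinP/measurable_funD => //; exact: measurable_funM.
have my n : measurable_fun setT (y n).
  apply: measurable_funD; apply: measurable_funM => //.
  by apply: measurable_minr.
have y0 n x : (0 <= y n x)%R.
  by rewrite addr_ge0// mulr_ge0// le_min e0.
have Bnd m n x : (m <= n)%N -> B m x -> B n x.
  move=> mn [Ax Bx]; split=> //; apply: le_trans Bx.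
  by rewrite lee_fin lerD2l ler_wpM2r// sgnd.
have ynd x m n : (m <= n)%N -> (W x * y m x)%:E <= (W x * y n x)%:E.
  move=> mn; rewrite lee_fin ler_wpM2l ?powR_ge0// lerD2r ler_wpM2l//.
  rewrite !indicE ler_nat; case: (boolP (x \in B m)) => //; rewrite inE => Bx.
  by rewrite mem_set//; exact: Bnd Bx.
have ycvg x : (W x * y n x)%:E @[n --> \oo] -->
    (W x * (e x * \1_(~` A) x + Num.min (e x) (t * kappa) * \1_A x))%:E.
  have [Ax|Ax] := pselect (A x).
    rewrite (_ : (fun n => _) = cst (W x * (e x * \1_(~` A) x + Num.min (e x) (t * kappa) * \1_A x))%:E).
      exact: cvg_cst.
    apply/funext => n; rewrite /y !indicE; congr (_ * (_ * _ + _))%:E.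
    by congr (nat_of_bool _)%:R; rewrite !memNset//= => -[].
  apply: cvg_near_cst.
  suff : \forall n \near \oo, (s x + sg n * e x)%:E <= cap.
    apply: filterS => n sc; rewrite /y !indicE (memNset Ax) mem_set//.
    by rewrite mem_set.
  have [a00|aN0] := eqVneq alpha 0%R.
    by apply: nearW => n; rewrite a00 inve0 leey.
  have capE : cap = kappa%:E by rewrite inver (negbTE aN0).
  have d0 : (0 < kappa - s x)%R.
    rewrite subr_gt0 lt_neqAle -lee_fin -capE s_cap andbT.
    by apply/eqP => sk; apply: Ax; rewrite /A /= capE -sk.
  have e1 : (0 < e x + 1)%R by rewrite ltr_wpDl.
  have t1 : (0 < t + 1)%R by rewrite ltr_wpDl.
  have r0 : (0 < (kappa - s x) * (t + 1) / (e x + 1))%R.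
    by apply: divr_gt0 => //; exact: mulr_gt0.
  apply: filterS (near_infty_natSinv_lt (PosNum r0)) => n /= nr.
  rewrite capE lee_fin -lerBrDl /sg invfM mulrAC mulrC.
  apply: (@le_trans _ _ ((kappa - s x) * (t + 1) / (e x + 1) * ((t + 1)^-1 * e x))%R).
    by rewrite ler_wpM2r ?(ltW nr)// mulr_ge0// invr_ge0 ltW.
  rewrite (_ : _ * _ = (kappa - s x) * (e x / (e x + 1)))%R; last first.
    by field; rewrite aN0 !gt_eqF.
  by apply: ler_piMr; rewrite ?(ltW d0)// ler_pdivrMr// mul1r lerDl ler01.
have intcvg : \int[Qa]_x (W x * y n x)%:E @[n --> \oo] -->
    \int[Qa]_x (W x * (e x * \1_(~` A) x + Num.min (e x) (t * kappa) * \1_A x))%:E.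
  rewrite [X in _ --> X](_ : _ = \int[Qa]_x (limn (fun n => (W x * y n x)%:E))).
    apply: cvg_monotone_convergence => //.
    - by move=> n; apply/measurable_EFinP; exact: measurable_funM.
    - by move=> n x _; rewrite lee_fin; exact: Wu_ge0.
    - by move=> x _ m n; exact: ynd.
  by apply: eq_integral => x _; apply/esym/cvg_lim.
rewrite -(cvg_lim _ intcvg)//; apply: lime_le; first exact: cvgP intcvg.
by apply: nearW => n; exact: directional_step.
Qed.

Local Notation S := (@bounded_measurable d X R).

Let w x := (W x * \1_A x)%R.
Let wB x := (W x * \1_(~` A) x)%R.

Let iw : Qa.-integrable setT (EFin \o w).
Proof. exact: (integrable_bounded_measurable iW (bounded_measurable_indic R mA)). Qed.

Let iwB : Qa.-integrable setT (EFin \o wB).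
Proof.
apply: (integrable_bounded_measurable iW); apply: bounded_measurable_indic.
exact: measurableC.
Qed.

Let w0 x : (0 <= w x)%R. Proof. by rewrite mulr_ge0// powR_ge0. Qed.
Let wB0 x : (0 <= wB x)%R. Proof. by rewrite mulr_ge0// powR_ge0. Qed.

Let wDwB x : (wB x + w x)%R = W x.
Proof.
rewrite /wB /w -mulrDr !indicE in_setC; case: (x \in A).
  by rewrite add0r mulr1.
by rewrite addr0 mulr1.
Qed.

Let mw : measurable_fun setT w.
Proof. by apply/measurable_EFinP; exact: measurable_int iw. Qed.
Let mwB : measurable_fun setT wB.
Proof. by apply/measurable_EFinP; exact: measurable_int iwB. Qed.

Let iWs : Qa.-integrable setT (fun x => (W x * s x)%:E).
Proof.
apply: integrable_ge0; first exact: measurable_funM.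
- exact: Wu_ge0.
- by have [c ->] := WsR; rewrite ltry.
Qed.

Let iwBs : Qa.-integrable setT (fun x => (wB x * s x)%:E).
Proof.
apply: (le_integrable measurableT _ _ iWs).
  by apply/measurable_EFinP; exact: measurable_funM.
move=> x _; rewrite /= !ger0_norm ?mulr_ge0 ?powR_ge0 ?s0// lee_fin ler_wpM2r ?s0//.
by rewrite -wDwB lerDl.
Qed.

Let RE (f : X -> R) : Qa.-integrable setT (fun x => (f x)%:E) ->
  \int[Qa]_x (f x)%:E = (\int[Qa]_x f x)%R%:E.
Proof. by move=> fi; rewrite /Rintegral fineK// integrable_fin_num. Qed.

Let iD (f g : X -> R) : Qa.-integrable setT (fun x => (f x)%:E) ->
  Qa.-integrable setT (fun x => (g x)%:E) ->
  Qa.-integrable setT (fun x => (f x + g x)%:E).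
Proof.
move=> fi gi.
rewrite (_ : (fun x => _) = (fun x => (f x)%:E) \+ (fun x => (g x)%:E))//.
exact: integrableD.
Qed.

Let iZl (r : R) (f : X -> R) : Qa.-integrable setT (fun x => (f x)%:E) ->
  Qa.-integrable setT (fun x => (r * f x)%:E).
Proof.
move=> fi; rewrite (_ : (fun x => _) = (fun x => r%:E * (f x)%:E))//.
exact: integrableZl.
Qed.

(* The constraints of interest are those with [t = 1], where [e] is a bounded
   e-value; the variable [t >= 0] homogenizes them into a convex cone. *)
Let K : set ((X -> R) * R) := [set b | exists (t : R) (e : X -> R),
  [/\ (0 <= t)%R, S e /\ (forall x, 0 <= e x)%R,
      forall P, H P -> \int[P]_x (e x)%:E <= t%:E,
      b.1 = (cst (t * kappa) - e)%R
    & b.2 = (\int[Qa]_x (wB x * e x) - t * \int[Qa]_x (wB x * s x))%R]].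

Let p (f : X -> R) : R := (\int[Qa]_x (w x * Num.max (f x) 0))%R.

Let K_le b : K b -> (b.2 <= p b.1)%R.
Proof.
move=> [t [e [t0 [Se e0] He -> ->]]].
have [me [M eM]] := Se.
have a0 : (0 <= alpha)%R by have /andP[] := alpha01.
have tk0 : (0 <= t * kappa)%R by rewrite mulr_ge0// invr_ge0.
pose m x := Num.min (e x) (t * kappa)%R.
have Sm : S m.
  split; first exact: measurable_minr.
  exists M => x; rewrite ger0_norm ?le_min ?e0//.
  by rewrite ge_min (le_trans (ler_norm _) (eM x)).
have iwBe := integrable_bounded_measurable iwB Se.
have iwm := integrable_bounded_measurable iw Sm.
have iwk : Qa.-integrable setT (fun x => (w x * kappa)%:E).
  exact: (integrable_bounded_measurable iw (bounded_measurable_cst X kappa)).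
have := directional t0 me e0 He.
rewrite (RE iWs) -EFinM.
rewrite (_ : (fun x => _) = (fun x => (wB x * e x + w x * m x)%:E)); last first.
  by apply/funext => x; congr EFin; rewrite /wB /w /m; ring.
rewrite RE; last exact: iD.
rewrite lee_fin RintegralD//.
rewrite (_ : (\int[Qa]_x (W x * s x))%R = (\int[Qa]_x (wB x * s x + w x * kappa))%R).
  rewrite RintegralD// => H1.
  rewrite (_ : p _ = (\int[Qa]_x (t * (w x * kappa) - w x * m x))%R); last first.
    apply: eq_Rintegral => x _; rewrite mulrCA -mulrBr; congr (_ * _)%R.
    rewrite /m addrfctE opprfctE /cst.
    by case: (leP (e x)) => ?; case: (leP _ 0%R) => ?; lra.
  rewrite RintegralB//.
    by rewrite RintegralZl//; lra.
  exact: iZl.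
apply: eq_Rintegral => x _; rewrite -wDwB mulrDl; congr (_ + _)%R.
have [Ax|Ax] := pselect (A x); first by rewrite (sA Ax).
by rewrite /w indicE memNset// mulr0 !mul0r.
Qed.

Let K_below : cone_below S p K.
Proof.
have SS e t : S e -> S (cst t - e)%R.
  move=> Se; rewrite -scaleN1r; apply: bounded_measurableD.
    exact: bounded_measurable_cst.
  exact: bounded_measurableZ.
have iwBe e : S e -> Qa.-integrable setT (fun x => (wB x * e x)%:E).
  exact: integrable_bounded_measurable.
split.
- exists 0%R, (cst 0%R); split => //=.
  + by split; [exact: bounded_measurable_cst|].
  + by move=> P _; rewrite integral0.
  + by rewrite mul0r; apply/funext => x; rewrite addrfctE opprfctE /cst subr0.
  + rewrite mul0r subr0 (@eq_Rintegral _ _ _ _ _ (cst 0%R)).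
      by rewrite Rintegral_cst// mul0r.
    by move=> x _; rewrite mulr0.
- move=> b b' [t [e [t0 [Se e0] He -> ->]]] [t' [e' [t0' [Se' e0'] He' -> ->]]].
  exists (t + t')%R, (e + e')%R; split => /=.
  + exact: addr_ge0.
  + by split; [exact: bounded_measurableD|move=> x; exact: addr_ge0].
  + move=> P HP; rewrite EFinD.
    under eq_integral do rewrite addrfctE EFinD.
    case: (Se) => me _; case: (Se') => me' _.
    rewrite ge0_integralD//; try exact/measurable_EFinP;
      try by move=> x _; rewrite lee_fin.
    by apply: leeD; [exact: He|exact: He'].
  + by apply/funext => x; rewrite !addrfctE !opprfctE /cst; ring.
  + rewrite (_ : (\int[Qa]_x (wB x * (e + e')%R x))%R =
      (\int[Qa]_x (wB x * e x + wB x * e' x))%R); last first.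
      by apply: eq_Rintegral => x _; rewrite addrfctE mulrDr.
    by rewrite RintegralD//; [ring|exact: iwBe|exact: iwBe].
- move=> r b r0 [t [e [t0 [Se e0] He -> ->]]].
  exists (r * t)%R, (r *: e)%R; split => /=.
  + exact: mulr_ge0.
  + split; [exact: bounded_measurableZ|move=> x].
    by rewrite scalrfctE; exact: mulr_ge0.
  + move=> P HP; rewrite EFinM.
    under eq_integral do rewrite scalrfctE EFinM.
    case: (Se) => me _.
    rewrite ge0_integralZl ?lee_fin//; first by rewrite lee_wpmul2l ?lee_fin// He.
      exact/measurable_EFinP.
    by move=> x _; rewrite lee_fin.
  + apply/funext => x.
    have rE : (r * (t * kappa - e x) = r * t * kappa - r * e x)%R by ring.
    exact: rE.
  + rewrite (_ : (\int[Qa]_x (wB x * (r *: e)%R x))%R =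
      (\int[Qa]_x (r * (wB x * e x)))%R); last first.
      by apply: eq_Rintegral => x _; rewrite scalrfctE mulrCA.
    by rewrite RintegralZl//; [ring|exact: iwBe].
- move=> b Kb; split; last exact: K_le.
  by case: Kb => t [e [_ [Se _] _ -> _]]; exact: SS.
Qed.

(** Outside [A] the function [k] is [W]; on [A] it is the density [v] of the
    functional given by the sandwich theorem.  The inequality first holds for the
    truncations [min(u, n)], which are bounded, then for [u]. *)
Lemma multiplier_exists : exists k : X -> R,
  [/\ measurable_fun setT k, forall x, (0 <= k x <= W x)%R,
      forall x, (s x)%:E <> cap -> k x = W x
    & forall u, valid_evalue H (EFin \o u) ->
        \int[Qa]_x (k x * u x)%:E <= \int[Qa]_x (k x * s x)%:E].
Proof.
have [G [GD GZ Gp GK]] := sandwich (bounded_measurable_cst X 0%R)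
  (@bounded_measurableD _ _ _) (@bounded_measurableZ _ _ _)
  (integral_pos_sublinear iw w0) K_below.
have [v [mv v0w Gv]] := dominated_functional_density
  (lebesgue_decomposition_fin HQ) iw w0 GD GZ Gp.
have v0 x : (0 <= v x)%R by have /andP[] := v0w x.
have vA x : ~ A x -> v x = 0%R.
  move=> Ax; have := v0w x; rewrite /w indicE memNset// mulr0 => vx.
  by apply/eqP; rewrite eq_le andbC.
have iv : Qa.-integrable setT (EFin \o v).
  apply: (le_integrable measurableT _ _ iw); first exact/measurable_EFinP.
  by move=> x _; have /andP[? ?] := v0w x; rewrite /= lee_fin !ger0_norm.
pose k x := (wB x + v x)%R.
have mk : measurable_fun setT k by exact: measurable_funD.
have kW x : (0 <= k x <= W x)%R.
  rewrite addr_ge0//= -wDwB lerD2l.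
  by have /andP[] := v0w x.
have k0 x : (0 <= k x)%R by have /andP[] := kW x.
exists k; split=> //.
  by move=> x sx; rewrite /k vA// addr0 -wDwB /w indicE memNset// mulr0 addr0.
move=> u vu.
have um := valid_evalue_measurable vu; have u0 := valid_evalue_ge0 vu.
pose e n x := Num.min (u x) n%:R.
have me n : measurable_fun setT (e n) by exact: measurable_minr.
have e0 n x : (0 <= e n x)%R by rewrite le_min u0/=.
have Se n : S (e n).
  by split=> //; exists n%:R => x; rewrite ger0_norm// ge_min lexx orbT.
have vs x : (v x * s x = kappa * v x)%R.
  have [Ax|Ax] := pselect (A x); first by rewrite (sA Ax) mulrC.
  by rewrite vA// mul0r mulr0.
have iks : Qa.-integrable setT (fun x => (k x * s x)%:E).
  rewrite (_ : (fun x => _) = (fun x => (wB x * s x + kappa * v x)%:E)).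
    by apply: iD => //; exact: iZl.
  by apply/funext => x; rewrite mulrDl vs.
have step n : \int[Qa]_x (k x * e n x)%:E <= \int[Qa]_x (k x * s x)%:E.
  have Ke : K ((cst (1 * kappa) - e n)%R,
      (\int[Qa]_x (wB x * e n x) - 1 * \int[Qa]_x (wB x * s x))%R).
    exists 1%R, (e n); split=> // P HP.
    have [_ _ /(_ P HP)] := vu; apply: le_trans.
    apply: ge0_le_integral => //.
    - by move=> x _; rewrite lee_fin.
    - exact/measurable_EFinP.
    - exact/measurable_EFinP.
    - by move=> x _; rewrite lee_fin ge_min lexx.
  have := GK _ Ke; rewrite /= Gv; last first.
    by have [_ _ _ /(_ _ Ke)[]] := K_below.
  have ive := integrable_bounded_measurable iv (Se n).
  have iwe := integrable_bounded_measurable iwB (Se n).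
  rewrite (_ : (\int[Qa]_x (v x * (cst (1 * kappa) - e n)%R x))%R =
    (\int[Qa]_x (kappa * v x - v x * e n x))%R); last first.
    apply: eq_Rintegral => x _; rewrite addrfctE opprfctE /cst; ring.
  rewrite RintegralB//; last exact: iZl.
  have -> : \int[Qa]_x (k x * e n x)%:E =
      (\int[Qa]_x (wB x * e n x) + \int[Qa]_x (v x * e n x))%R%:E.
    rewrite -RintegralD// -RE; last exact: iD.
    by apply: eq_integral => x _; rewrite mulrDl.
  have -> : \int[Qa]_x (k x * s x)%:E =
      (\int[Qa]_x (wB x * s x) + \int[Qa]_x (kappa * v x))%R%:E.
    rewrite -RintegralD//; last exact: iZl.
    rewrite RE//; congr EFin.
    by apply: eq_Rintegral => x _; rewrite mulrDl vs.
  by rewrite lee_fin; lra.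
have intcvg : \int[Qa]_x (k x * e n x)%:E @[n --> \oo] --> \int[Qa]_x (k x * u x)%:E.
  have ecvg x : (k x * e n x)%:E @[n --> \oo] --> (k x * u x)%:E.
    apply: cvg_near_cst; apply: filterS (nbhs_infty_ger (u x)) => n un.
    by rewrite /e; congr (_ * _)%:E; apply/min_idPl.
  rewrite [X in _ --> X](_ : _ = \int[Qa]_x (limn (fun n => (k x * e n x)%:E))).
    apply: cvg_monotone_convergence => //.
    - by move=> n; apply/measurable_EFinP; exact: measurable_funM.
    - by move=> n x _; rewrite lee_fin mulr_ge0.
    - move=> x _ m n mn; rewrite lee_fin ler_wpM2l// le_min !ge_min lexx/=.
      by rewrite ler_nat mn orbT.
  by apply: eq_integral => x _; apply/esym/cvg_lim.
rewrite -(cvg_lim _ intcvg)//; apply: lime_le; first exact: cvgP intcvg.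
exact: nearW.
Qed.

End multiplier.

(** If [lambda = 0] then [k s = 0], so [k = 0] almost surely; as inverses of 0
    are 0, the definition [f = k / lambda] also covers this case, with [P = 0]. *)
Lemma first_order_multiplier : first_order ->
  exists (lambda : R) (P : {measure set X -> \bar R}) (f : X -> R),
    [/\ (0 <= lambda)%R,
        effective_hypothesis H P /\ P `<< Qa,
        is_radon_nikodym_derivative P Qa f,
        {ae Qa, forall x, estar x =
          mine (epow (lambda * f x)%:E (- (1 - h)^-1)) cap}
      & lambda%:E * (1 - \int[P]_x estar x) = 0].
Proof.
move=> FO; have [k [mk kW kWE k_le]] := multiplier_exists FO.
have [sp Zoo _] := FO.
have k0 x : (0 <= k x)%R by have /andP[] := kW x.
have mks : measurable_fun setT (fun x => k x * s x)%R by exact: measurable_funM.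
pose lambda := fine (\int[Qa]_x (k x * s x)%:E).
have lambdaE : \int[Qa]_x (k x * s x)%:E = lambda%:E.
  rewrite fineK// ge0_fin_numE; last first.
    by apply: integral_ge0 => x _; rewrite lee_fin mulr_ge0.
  apply: le_lt_trans Zoo; apply: ae_ge0_le_integral => //.
  - by move=> x _; rewrite lee_fin mulr_ge0.
  - exact/measurable_EFinP.
  - by move=> x _; rewrite lee_fin.
  - exact/measurable_EFinP.
  apply: filterS sp => x sx _; rewrite -(WsZ sx) lee_fin ler_wpM2r ?s0//.
  by have /andP[] := kW x.
have l0 : (0 <= lambda)%R.
  by apply: fine_ge0; apply: integral_ge0 => x _; rewrite lee_fin mulr_ge0.
pose f x := (lambda^-1 * k x)%R.
have mf : measurable_fun setT f by exact: measurable_funM.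
have f0 x : (0 <= f x)%R by rewrite mulr_ge0// invr_ge0.
have [P PQa] := density_measure_exists Qa mf f0.
have intP e : valid_evalue H e ->
    \int[P]_x e x = (lambda^-1)%:E * \int[Qa]_x (k x * fine (e x))%:E.
  move=> ve; have [me e0 _] := ve.
  rewrite (integral_density PQa)// -ge0_integralZl//; last 3 first.
  - by apply/measurable_EFinP; apply: measurable_funM => //; exact: measurableT_comp.
  - by move=> x _; rewrite lee_fin mulr_ge0// fine_ge0.
  - by rewrite lee_fin invr_ge0.
  apply: ae_eq_integral => //.
  - by apply: emeasurable_funM => //; exact/measurable_EFinP.
  - apply: emeasurable_funM => //; apply/measurable_EFinP.
    by apply: measurable_funM => //; exact: measurableT_comp.
  - apply: filterS (valid_evalue_ae_fine HQ ve) => x {1}-> _.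
    by rewrite -!EFinM /f mulrA.
have lfk : {ae Qa, forall x, (lambda * f x)%R = k x}.
  have [l00|lN0] := eqVneq lambda 0%R; last first.
    by apply: aeW => x; rewrite mulrA divff// mul1r.
  have : \int[Qa]_x `|(k x * s x)%:E| = 0.
    by under eq_integral do rewrite gee0_abs ?lee_fin ?mulr_ge0//; rewrite lambdaE l00.
  move/(ae_eq_integral_abs _ measurableT) => H0.
  have := H0 ((measurable_EFinP _ _).2 mks).
  apply: filterS2 sp => x sx /(_ I)/= [] /eqP.
  by rewrite mulf_eq0 (gt_eqF sx) orbF l00 mul0r => /eqP.
exists lambda, P, f; split=> //.
- split.
    move=> e ve; rewrite intP//.
    apply: (@le_trans _ _ ((lambda^-1)%:E * lambda%:E)).
      rewrite lee_wpmul2l ?lee_fin ?invr_ge0// -lambdaE.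
      exact: k_le (valid_evalue_fine ve).
    rewrite -EFinM lee_fin; have [->|lN0] := eqVneq lambda 0%R.
      by rewrite mulr0 ler01.
    by rewrite mulVf.
  apply/null_content_dominatesP => B mB QaB; have [_ _ ->//] := PQa.
  by rewrite null_set_integral//; exact/measurable_funTS/measurable_EFinP.
- apply: filterS3 estar_fine sp lfk => x sE sx lfE; rewrite lfE sE.
  have c0 : (0 < (1 - h)^-1)%R by rewrite invr_gt0 subr_gt0.
  have WsK : (W x `^ (- (1 - h)^-1) = s x)%R.
    rewrite /= -powRrM -[X in (X * _)%R]opprB mulrNN divff ?powRr1 ?(ltW sx)//.
    by rewrite subr_eq0 gt_eqF.
  have [sc|sc] := eqVneq (s x)%:E cap; last first.
    rewrite kWE; last by apply/eqP.
    by rewrite epow_EFin ?powR_gt0// WsK min_l.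
  rewrite min_r ?sc//; have [kx|kN0] := eqVneq (k x) 0%R.
    by rewrite kx /epow oppr_lt0 c0 opprK poweR0r ?gt_eqF// inve0 leey.
  have kx0 : (0 < k x)%R by rewrite lt0r kN0 k0.
  rewrite -sc epow_EFin// -WsK lee_fin; apply: powR_antitone => //.
    by rewrite oppr_le0 ltW.
  by have /andP[] := kW x.
- rewrite intP// lambdaE -EFinM.
  have [->|lN0] := eqVneq lambda 0%R; first by rewrite mul0r.
  by rewrite mulVf// subrr mulr0.
Qed.

Lemma first_order_positive : first_order -> {ae Qa, forall x, 0 < estar x}.
Proof.
by move=> [sp _ _]; apply: filterS2 estar_fine sp => x -> sx; rewrite lte_fin.
Qed.

End optimality.

Unset Implicit Arguments.
Local Open Scope ereal_scope.

Theorem corollary8 (d : measure_display) (X : measurableType d) (R : realType)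
    (H : set (probability X R)) (Q : probability X R)
    (Qa Qs : {measure set X -> \bar R})
    (HQ : generalized_lebesgue_decomposition H Q Qa Qs)
    (alpha h : R) (alpha01 : (0 <= alpha <= 1)%R) (h1 : (h < 1)%R)
    (estar : X -> \bar R) (estar_valid : valid_evalue H estar)
    (estar_cap : forall x, estar x <= (alpha%:E)^-1)
    (estar_moment : alpha = 0%R -> (0 < h)%R ->
       \int[Qa]_x epow (estar x) h < +oo) :
  [<-> utility_optimal H Qa (capped_power_utility alpha h) estar;
       forall e, valid_evalue H e -> (forall x, e x <= (alpha%:E)^-1) ->
         Qa.-integrable setT
           (fun x => epow (estar x) (h - 1) * (e x - estar x)) /\
         \int[Qa]_x (epow (estar x) (h - 1) * (e x - estar x)) <= 0;
       exists (lambda : R) (P : {measure set X -> \bar R}) (f : X -> R),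
         [/\ (0 <= lambda)%R,
             effective_hypothesis H P /\ P `<< Qa,
             is_radon_nikodym_derivative P Qa f,
             {ae Qa, forall x, estar x =
                mine (epow (lambda * f x)%:E (- (1 - h)^-1)) (alpha%:E)^-1}
           & lambda%:E * (1 - \int[P]_x estar x) = 0] ]
  /\
  (utility_optimal H Qa (capped_power_utility alpha h) estar ->
     {ae Qa, forall x, 0 < estar x}).
Proof.
have opt_FO : utility_optimal H Qa (capped_power_utility alpha h) estar ->
    first_order H Qa alpha h estar.
  by move=> opt; apply: (optimal_first_order HQ).
split; last by move=> /opt_FO; apply: (first_order_positive HQ).
tfae.
- by move=> /opt_FO FO e ve ec; apply: (first_order_variation HQ alpha01).
- move=> V; apply: (first_order_multiplier HQ) => //.
  by apply: (variation_first_order HQ).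
- move=> [lambda [P [f [l0 [effP _] PQa estarE slack]]]].
  apply: (first_order_optimal HQ) => //.
  exact: (multiplier_first_order HQ alpha01 h1 estar_valid l0 effP PQa estarE
            slack).
Qed.
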